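(* Let $\gamma$ be a closed critical curve, with non-constant curvature $\kappa$, of $\mathbf{\Theta}(\gamma)=\int_\gamma P(\kappa)\,ds$ in $B(\rho)$ for any $d>0$, and consider the binormal evolution torus $\widetilde{S}_\gamma$ in $M^3(\rho)$ generated by evolving $\gamma$ under the binormal flow associated to $\mathcal{I}=\dot{P}(\kappa)B$. Then $\widetilde{S}_\gamma$ verifies $$\kappa_1=\kappa_2-\frac{P(\kappa)}{\dot{P}(\kappa)}$$ between its principal curvatures, $\kappa_1$ and $\kappa_2$.
   Context: $P$ is a smooth real function on an adequate domain; the upper dot is the derivative with respect to $\kappa$, and the subscript $s$ the derivative with respect to arc-length. $M^3(\rho)$ is a Riemannian 3-space form of constant sectional curvature $\rho\in\mathbb R$ and $B(\rho)$ is a totally geodesic surface of $M^3(\rho)$ (the simply connected surface of constant Gaussian curvature $\rho$); a curve in $B(\rho)$ is regarded as a planar (torsion-free) curve in $M^3(\rho)$. $\kappa$ is the (signed) geodesic curvature of $\gamma$ in $B(\rho)$. Critical curves of $\mathbf\Theta$ in $B(\rho)$ are the solutions of the Euler-Lagrange equation $\dot P_{ss}+\dot P(\kappa^2+\rho)-\kappa P=0$. When the curvature is non-constant it has the first integral $\dot P_s^2+(\kappa\dot P-P)^2+\rho\dot P^2=d$ with $d$ a constant; this is the $d$ in the statement. Let $T,N,B$ be the Frenet frame of $\gamma$ in $M^3(\rho)$ ($B$ being the unit normal of $B(\rho)$ along $\gamma$). For a critical curve $\gamma$, the vector field $\mathcal I=\dot P(\kappa)B$ along $\gamma$ is a Killing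 vector field along $\gamma$ and it extends uniquely to a Killing vector field on $M^3(\rho)$. For $d>0$ the one-parameter group of isometries $\{\widetilde\psi_t\}$ it generates consists of rotations of spherical type (orbits are Euclidean circles). The binormal evolution surface is $\widetilde S_\gamma=\{\widetilde\psi_t(\gamma(s))\}$; when $\gamma$ is closed it is a rotational torus in $M^3(\rho)$ with profile curve $\gamma$, called the binormal evolution torus. Principal curvatures are taken with respect to the unit normal equal to $-N$ along $\gamma$; $\kappa_1=-\kappa$ is the one in the direction of the profile curve and $\kappa_2$ the one in the direction of the rotation orbits. *)

(* Defs.v *)
From HB Require Import structures.
From mathcomp Require Import all_boot all_order all_algebra.
From mathcomp Require Import all_classical all_reals all_analysis.

Set Implicit Arguments.
Unset Strict Implicit.
Unset Printing Implicit Defensive.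

Import Order.TTheory GRing.Theory Num.Theory.
Import numFieldNormedType.Exports.

Local Open Scope classical_set_scope.
Local Open Scope ring_scope.

Section Smoothness.
Context {R : realType} {V : normedModType R}.

(* For an open set D this is C^oo on D. *)
Definition smooth_on (D : set R) (f : R -> V) : Prop :=
  forall (k : nat) (u : R), D u -> derivable (derive1n k f) u 1.

Definition smooth (f : R -> V) : Prop := smooth_on setT f.

End Smoothness.

(* The complete simply connected 3-space form M^3(rho), in a model that is
   uniform in rho:
     M^3(rho) = { x in R^4 | x0^2 + rho (x1^2 + x2^2 + x3^2) = 1 },
   restricted to x0 > 0 when rho <= 0, with the metric
     dx0^2 / rho + dx1^2 + dx2^2 + dx3^2.
   Rescaling x0 by |rho|^(-1/2) gives the round sphere of radius rho^(-1/2)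
   when rho > 0 and the hyperboloid model when rho < 0.  For rho = 0 it is the
   hyperplane x0 = 1, i.e. Euclidean 3-space: tangent vectors have v0 = 0, and
   0^-1 = 0 in a field, so the formulas below remain the right ones. *)
Section SpaceForm.
Context {R : realType}.
Variable rho : R.
Implicit Types (x v w n p : 'rV[R]_4) (c W : R -> 'rV[R]_4).

Definition head_coord v : R := v ord0 ord0.

Definition tail_dot v w : R :=
  \sum_(i < 3) v ord0 (lift ord0 i) * w ord0 (lift ord0 i).

Definition gdot v w : R :=
  rho^-1 * (head_coord v * head_coord w) + tail_dot v w.

Definition space_form : set 'rV[R]_4 :=
  [set x | head_coord x ^+ 2 + rho * tail_dot x x = 1 /\
           (rho <= 0 -> 0 < head_coord x)].

Definition tangent x v : Prop :=
  head_coord x * head_coord v + rho * tail_dot x v = 0.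

(* Orthogonal projection onto the tangent space at x, as gdot x x = rho^-1 when
   rho <> 0; it is the identity when rho = 0. *)
Definition tan_proj x w : 'rV[R]_4 := w - (rho * gdot x w) *: x.

(* Levi-Civita covariant derivative of the field W along the curve c. *)
Definition cov_deriv c W (u : R) : 'rV[R]_4 := tan_proj (c u) (derive1 W u).

(* The complete totally geodesic surface of M^3(rho) through p with unit normal
   n at p.  The constant vector n is a unit normal at each of its points. *)
Definition totally_geodesic_surface p n : set 'rV[R]_4 :=
  [set x | space_form x /\ gdot (x - p) n = 0].

(* Smoothness of a map is tested on smooth curves (Boman's theorem), and the
   metric is determined by the squared norms of velocities (polarization). *)
Definition isometric_map (f : 'rV[R]_4 -> 'rV[R]_4) : Prop :=
  (forall x, space_form x -> space_form (f x)) /\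
  (forall c, smooth c -> (forall u, space_form (c u)) ->
     smooth (f \o c) /\
     forall u, gdot (derive1 (f \o c) u) (derive1 (f \o c) u) =
               gdot (derive1 c u) (derive1 c u)).

Record one_parameter_isometry_group (psi : R -> 'rV[R]_4 -> 'rV[R]_4) : Prop :=
  OneParameterIsometryGroup {
    opg_isometric : forall t, isometric_map (psi t);
    opg_zero : forall x, space_form x -> psi 0 x = x;
    opg_add : forall t u x, space_form x -> psi (t + u) x = psi t (psi u x);
    opg_smooth : forall x, space_form x -> smooth (fun t => psi t x)
  }.

(* Killing field xi of M^3(rho), with its flow psi by isometries.  Killing
   fields are complete here since M^3(rho) is complete. *)
Definition killing_field_with_flow (xi : 'rV[R]_4 -> 'rV[R]_4)
    (psi : R -> 'rV[R]_4 -> 'rV[R]_4) : Prop :=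
  one_parameter_isometry_group psi /\
  forall x, space_form x -> derive1 (fun t => psi t x) 0 = xi x.

(* Unit speed curve gamma in the totally geodesic surface through p with unit
   normal n, with Frenet frame (gamma', N, n) and signed geodesic curvature
   kappa.  Both orientations are allowed for the frame. *)
Record frenet_curve p n (gamma N : R -> 'rV[R]_4) (kappa : R -> R) : Prop :=
  FrenetCurve {
    fc_smooth : smooth gamma;
    fc_surface : forall s, totally_geodesic_surface p n (gamma s);
    fc_unit_speed : forall s, gdot (derive1 gamma s) (derive1 gamma s) = 1;
    fc_normal_smooth : smooth N;
    fc_normal_tangent : forall s, tangent (gamma s) (N s);
    fc_normal_unit : forall s, gdot (N s) (N s) = 1;
    fc_normal_T : forall s, gdot (N s) (derive1 gamma s) = 0;
    fc_normal_n : forall s, gdot (N s) n = 0;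
    fc_curvature : forall s,
      cov_deriv gamma (derive1 gamma) s = kappa s *: N s
  }.

Definition closed_curve (gamma : R -> 'rV[R]_4) : Prop :=
  exists2 L : R, 0 < L & forall s, gamma (s + L) = gamma s.

(* Euler-Lagrange equation of gamma |-> int_gamma P(kappa) ds in B(rho). *)
Definition euler_lagrange (P kappa : R -> R) : Prop :=
  forall s, derive1n 2 (derive1 P \o kappa) s +
            derive1 P (kappa s) * (kappa s ^+ 2 + rho) -
            kappa s * P (kappa s) = 0.

Definition first_integral (P kappa : R -> R) (s : R) : R :=
  (derive1 (derive1 P \o kappa) s) ^+ 2 +
  (kappa s * derive1 P (kappa s) - P (kappa s)) ^+ 2 +
  rho * (derive1 P (kappa s)) ^+ 2.

(* Parametrized surfaces X(s, t) of M^3(rho). *)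
Implicit Types X nu : R -> R -> 'rV[R]_4.

Definition partial_s X (s t : R) : 'rV[R]_4 := derive1 (fun s' => X s' t) s.

Definition partial_t X (s t : R) : 'rV[R]_4 := derive1 (fun t' => X s t') t.

Record unit_normal X nu : Prop := UnitNormal {
  un_smooth_s : forall t, smooth (fun s => nu s t);
  un_smooth_t : forall s, smooth (nu s);
  un_tangent : forall s t, tangent (X s t) (nu s t);
  un_unit : forall s t, gdot (nu s t) (nu s t) = 1;
  un_normal_s : forall s t, gdot (nu s t) (partial_s X s t) = 0;
  un_normal_t : forall s t, gdot (nu s t) (partial_t X s t) = 0
}.

Definition shape_s X nu (s t : R) : 'rV[R]_4 :=
  - cov_deriv (fun s' => X s' t) (fun s' => nu s' t) s.

Definition shape_t X nu (s t : R) : 'rV[R]_4 :=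
  - cov_deriv (X s) (nu s) t.

(* X is immersed at (s, t) and its coordinate directions X_s, X_t are
   eigenvectors of the shape operator v |-> - nabla_v nu, with eigenvalues
   k1 and k2. *)
Definition principal_curvatures X nu (s t k1 k2 : R) : Prop :=
  [/\ free [:: partial_s X s t; partial_t X s t],
      shape_s X nu s t = k1 *: partial_s X s t
    & shape_t X nu s t = k2 *: partial_t X s t].

Definition binormal_evolution (psi : R -> 'rV[R]_4 -> 'rV[R]_4)
    (gamma : R -> 'rV[R]_4) : R -> R -> 'rV[R]_4 :=
  fun s t => psi t (gamma s).

End SpaceForm.

(* Main.v *)
Require Import Defs.
From HB Require Import structures.
From mathcomp Require Import all_boot all_order all_algebra.
From mathcomp Require Import all_classical all_reals all_analysis.
From mathcomp Require Import ring lra.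
Import Order.TTheory GRing.Theory Num.Theory.
Import numFieldNormedType.Exports.
Local Open Scope classical_set_scope.
Local Open Scope ring_scope.

(** The isometries psi_t are only known to preserve the speed of smooth curves,
so the first half of the proof shows that they are restrictions of linear maps
of R^4. A unit speed curve cannot outrun the geodesic with the same starting
point: Cauchy-Schwarz in the tangent spaces bounds the growth of its squared
chord, and [chord_comparison] integrates this bound. Applied to the image of a
geodesic, it shows that an isometric map does not increase chords
([isometric_map_chord_le]); as psi_t is inverted by psi_(-t), chords are
preserved. In the ambient space the chords determine the bilinear forms of the
model, so linear relations between points are preserved, and psi_t x = x A(t)
with A' = Om A and A(0) = 1 ([flow_linear]).

The geometry is then the following computation, with f = P'(kappa) and B = n the
constant binormal. Along gamma the Killing field is gamma Om = f n. One
derivative gives T Om = f' n. A second one, with the Frenet equation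
gamma'' = kappa N - rho gamma and the Euler-Lagrange equation, gives
kappa (N Om) = (f'' + rho f) n = kappa (P - kappa f) n. Skewness of Om forces
N Om = l n for a function l with l' = - kappa f' = (P - kappa f)'. So
l - (P - kappa f) is constant, and it vanishes where kappa does not; hence
l = P - kappa f everywhere ([binormal_rateE]).

The surface is X(s, t) = gamma(s) A(t), its coordinate directions are
X_s = T A(t) and X_t = f n A(t), and its unit normal is - N A(t). Differentiating
this normal in s and t gives the principal curvatures - kappa and
l / f = P / f - kappa, whose difference is - P / f. *)

(** * Derivatives of matrix-valued functions *)

Section Derivatives.
Context {R : realType}.

Lemma is_derive_derive1 {V : normedModType R} {f : R -> V} {u : R} {d : V} :
  is_derive u 1 f d -> derive1 f u = d.
Proof. by move=> fd; rewrite derive1E; exact: derive_val. Qed.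

Lemma derivable_is_derive1 {V : normedModType R} (f : R -> V) (u : R) :
  derivable f u 1 -> is_derive u 1 f (derive1 f u).
Proof. by move=> df; rewrite derive1E; exact: derivableP. Qed.

Lemma smooth_is_derive1 {V : normedModType R} {f : R -> V} (u : R) :
  smooth f -> is_derive u 1 f (derive1 f u).
Proof. by move=> sf; apply/derivable_is_derive1/(sf 0%N). Qed.

Lemma smooth_derive1 {V : normedModType R} {f : R -> V} :
  smooth f -> smooth (derive1 f).
Proof. by move=> sf k u _; rewrite -derive1Sn; exact: sf. Qed.

Lemma is_derive_sumE {V : normedModType R} {n} {h : 'I_n -> R -> V}
    {dh : 'I_n -> V} {u : R} :
  (forall i, is_derive u 1 (h i) (dh i)) ->
  is_derive u 1 (fun z => \sum_(i < n) h i z) (\sum_(i < n) dh i).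
Proof.
move=> hd; have -> : (fun z => \sum_(i < n) h i z) = \sum_(i < n) h i.
  by apply/funext => z; rewrite fct_sumE.
exact: is_derive_sum.
Qed.

Lemma is_derive_mul {f g : R -> R} {u df dg : R} :
  is_derive u 1 f df -> is_derive u 1 g dg ->
  is_derive u 1 (fun z => f z * g z) (df * g u + f u * dg).
Proof.
move=> fd gd; apply: is_derive_eq (is_deriveM fd gd) _.
by rewrite /GRing.scale /= addrC mulrC.
Qed.

Lemma is_derive_coord {m n} {c : R -> 'M[R]_(m.+1, n.+1)}
    {c' : 'M[R]_(m.+1, n.+1)} {u : R} i j :
  is_derive u 1 c c' -> is_derive u 1 (fun z => c z i j) (c' i j).
Proof.
move=> [dc <-]; rewrite (derive_mx dc) mxE.
by apply/derivableP; move: i j; exact/derivable_mxP.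
Qed.

Lemma is_derive_mx {m n} {c : R -> 'M[R]_(m.+1, n.+1)}
    {c' : 'M[R]_(m.+1, n.+1)} {u : R} :
  (forall i j, is_derive u 1 (fun z => c z i j) (c' i j)) ->
  is_derive u 1 c c'.
Proof.
move=> dc; have dc1 : derivable c u 1 by apply/derivable_mxP => i j; case: (dc i j).
apply: DeriveDef => //; rewrite (derive_mx dc1); apply/matrixP => i j.
by rewrite mxE; exact: derive_val.
Qed.

Lemma is_derive_mulmx {m n p} {A : R -> 'M[R]_(m.+1, n.+1)}
    {A' : 'M[R]_(m.+1, n.+1)} {B : R -> 'M[R]_(n.+1, p.+1)}
    {B' : 'M[R]_(n.+1, p.+1)} {u : R} :
  is_derive u 1 A A' -> is_derive u 1 B B' ->
  is_derive u 1 (fun z => A z *m B z) (A' *m B u + A u *m B').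
Proof.
move=> dA dB; apply: is_derive_mx => i j; rewrite 3!mxE -big_split/=.
under eq_fun do rewrite mxE.
by apply: is_derive_sumE => k; apply: is_derive_mul; exact: is_derive_coord.
Qed.

Lemma is_derive_mulmxr {m n p} {A : R -> 'M[R]_(m.+1, n.+1)}
    {A' : 'M[R]_(m.+1, n.+1)} {u : R} (B : 'M[R]_(n.+1, p.+1)) :
  is_derive u 1 A A' -> is_derive u 1 (fun z => A z *m B) (A' *m B).
Proof.
move=> dA; have := is_derive_mulmx dA (is_derive_cst B u 1).
by move=> /is_derive_eq; apply; rewrite mulmx0 addr0.
Qed.

Lemma is_derive_scalel {m n} {k : R -> R} {k' u : R} (M : 'M[R]_(m.+1, n.+1)) :
  is_derive u 1 k k' -> is_derive u 1 (fun z => k z *: M) (k' *: M).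
Proof.
move=> dk; apply: is_derive_mx => i j; rewrite mxE.
under eq_fun do rewrite mxE.
by apply: is_derive_eq (is_derive_mul dk (is_derive_cst (M i j) u 1)) _;
  rewrite mulr0 addr0.
Qed.

End Derivatives.

(** * The two bilinear forms of the model *)

Section WeightedForm.
Context {R : realType}.
Implicit Types (a b k : R) (v w x : 'rV[R]_4).

(** The metric is [wform rho^-1 1], and the space form is a piece of the unit
level set of [wform 1 rho]. These forms, written g and q below, are proportional
when rho <> 0; for rho = 0 they are complementary, g reading the tail and q the
head coordinate. *)
Definition wform a b v w : R :=
  a * (head_coord v * head_coord w) + b * tail_dot v w.

Lemma gdotE rho v w : gdot rho v w = wform rho^-1 1 v w.
Proof. by rewrite /gdot /wform mul1r. Qed.

Lemma tangentE rho x v : tangent rho x v <-> wform 1 rho x v = 0.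
Proof. by rewrite /tangent /wform mul1r. Qed.

Lemma wformC a b v w : wform a b v w = wform a b w v.
Proof.
by rewrite /wform /tail_dot mulrC [_ * head_coord w]mulrC mulrC;
  congr (_ + b * _); apply: eq_bigr => i _; rewrite mulrC.
Qed.

Lemma wformDl a b v v' w : wform a b (v + v') w = wform a b v w + wform a b v' w.
Proof. by rewrite /wform /tail_dot !big_ord_recl !big_ord0 /head_coord !mxE; ring. Qed.

Lemma wformZl a b k v w : wform a b (k *: v) w = k * wform a b v w.
Proof. by rewrite /wform /tail_dot !big_ord_recl !big_ord0 /head_coord !mxE; ring. Qed.

Lemma wformNl a b v w : wform a b (- v) w = - wform a b v w.
Proof. by rewrite -scaleN1r wformZl mulN1r. Qed.

Lemma wformDr a b v w w' : wform a b v (w + w') = wform a b v w + wform a b v w'.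
Proof. by rewrite wformC wformDl !(wformC _ _ _ v). Qed.

Lemma wformZr a b k v w : wform a b v (k *: w) = k * wform a b v w.
Proof. by rewrite wformC wformZl (wformC _ _ _ v). Qed.

Lemma wformNr a b v w : wform a b v (- w) = - wform a b v w.
Proof. by rewrite wformC wformNl (wformC _ _ _ v). Qed.

Lemma wform0l a b w : wform a b 0 w = 0.
Proof. by rewrite -(scale0r 0) wformZl mul0r. Qed.

Lemma wform_suml a b (I : finType) (F : I -> 'rV[R]_4) w :
  wform a b (\sum_i F i) w = \sum_i wform a b (F i) w.
Proof.
by apply: (big_morph (fun v => wform a b v w)) => [v v'|];
  [exact: wformDl|exact: wform0l].
Qed.

Definition wformE := (wformDl, wformDr, wformZl, wformZr, wformNl, wformNr).

Lemma is_derive_wform a b {c w : R -> 'rV[R]_4} {c' w' : 'rV[R]_4} {u : R} :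
  is_derive u 1 c c' -> is_derive u 1 w w' ->
  is_derive u 1 (fun z => wform a b (c z) (w z))
    (wform a b c' (w u) + wform a b (c u) w').
Proof.
move=> dc dw.
have dj j : is_derive u 1 (fun z => c z ord0 j * w z ord0 j)
    (c' ord0 j * w u ord0 j + c u ord0 j * w' ord0 j).
  by apply: is_derive_mul; exact: is_derive_coord.
have dtl := is_derive_sumE (fun i : 'I_3 => dj (lift ord0 i)).
apply: is_derive_eq (is_deriveD (is_deriveZ a (dj ord0)) (is_deriveZ b dtl)) _.
rewrite /wform /tail_dot /head_coord /GRing.scale /= big_split/=.
ring.
Qed.

Lemma wform_cst_derive {a b : R} {c w : R -> 'rV[R]_4} {c' w' : 'rV[R]_4}
    {u k : R} :
  is_derive u 1 c c' -> is_derive u 1 w w' ->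
  (forall z, wform a b (c z) (w z) = k) ->
  wform a b c' (w u) + wform a b (c u) w' = 0.
Proof.
move=> dc dw cst_k; have /is_derive_derive1 <- := is_derive_wform a b dc dw.
have -> : (fun z => wform a b (c z) (w z)) = cst k by apply/funext.
by rewrite derive1_cst.
Qed.

End WeightedForm.

(** * Tangent vectors and chords of the space form *)

Section SpaceFormGeometry.
Context {R : realType}.
Variable rho : R.
Implicit Types (v w x y : 'rV[R]_4).
Local Notation g := (wform rho^-1 1).
Local Notation q := (wform 1 rho).
Local Notation sf := (space_form rho).

(** This is the condition on v that makes q x v = rho * g x v true for every
rho. It holds for tangent vectors and for differences of points. *)
Definition horizontal v : Prop := rho = 0 -> head_coord v = 0.

Lemma tail_dot_ge0 v : 0 <= tail_dot v v.
Proof. by apply: sumr_ge0 => i _; rewrite -expr2 sqr_ge0. Qed.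

Lemma tail_dot_eq0 v : tail_dot v v = 0 -> head_coord v = 0 -> v = 0.
Proof.
move=> /eqP; rewrite psumr_eq0; last by move=> i _; rewrite -expr2 sqr_ge0.
move=> /allP tv hv; apply/rowP => j; rewrite mxE.
have [->//|] := eqVneq j ord0; rewrite eq_sym => /unlift_some[i -> _].
by have := tv i (mem_index_enum i); rewrite /= mulf_eq0 orbb => /eqP.
Qed.

Lemma tail_dot_CS v w : tail_dot v w ^+ 2 <= tail_dot v v * tail_dot w w.
Proof.
rewrite /tail_dot !big_ord_recl !big_ord0 !addr0.
set a := v _ _; set b := v _ _; set c := v _ _.
set a' := w _ _; set b' := w _ _; set c' := w _ _.
rewrite -subr_ge0 (_ : _ - _ = (a * b' - b * a') ^+ 2 + (a * c' - c * a') ^+ 2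
  + (b * c' - c * b') ^+ 2); last by ring.
by rewrite !addr_ge0 ?sqr_ge0.
Qed.

Lemma space_form_q x : sf x -> q x x = 1.
Proof. by case=> + _; rewrite /wform mul1r expr2. Qed.

Lemma space_form_head_eq1 x : sf x -> rho = 0 -> head_coord x = 1.
Proof.
case=> + + r0; rewrite r0 mul0r addr0 => /eqP; rewrite sqrf_eq1 => /orP[]/eqP -> //.
by move=> /(_ (lexx _)); rewrite oppr_gt0 ltr10.
Qed.

Lemma q_horizontal v x : horizontal v -> q x v = rho * g x v.
Proof.
rewrite /wform /horizontal; have [-> /(_ erefl) ->|r0 _] := eqVneq rho 0.
  by rewrite !mulr0 !mul0r addr0.
by rewrite mulrDr (mulrA rho rho^-1) divff// !mul1r.
Qed.

Lemma tangent_horizontal x v : sf x -> q x v = 0 -> horizontal v.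
Proof.
by move=> sx + r0; rewrite /wform (space_form_head_eq1 x sx r0) r0 mul0r addr0 !mul1r.
Qed.

Lemma horizontalD v w : horizontal v -> horizontal w -> horizontal (v + w).
Proof.
move=> hv hw r0; have := hv r0; have := hw r0.
by rewrite /head_coord mxE => -> ->; rewrite addr0.
Qed.

Lemma space_form_sub_horizontal x y : sf x -> sf y -> horizontal (x - y).
Proof.
move=> sx sy r0; rewrite /head_coord !mxE.
have := space_form_head_eq1 x sx r0; have := space_form_head_eq1 y sy r0.
by rewrite /head_coord => -> ->; rewrite subrr.
Qed.

Lemma rho2_gdot x : sf x -> rho * rho * g x x = rho.
Proof.
move=> sx; have [->|r0] := eqVneq rho 0; first by rewrite !mul0r.
have hx : horizontal x by move=> e; rewrite e eqxx in r0.
by rewrite -mulrA -q_horizontal// space_form_q// mulr1.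
Qed.

(** Squared chords work for all signs of rho: they are affine functions of q
when rho <> 0, and squared Euclidean distances when rho = 0, where q is constant
on the space form. *)
Definition chord x y : R := g (x - y) (x - y).

Lemma chordC x y : chord x y = chord y x.
Proof. by rewrite /chord -opprB wformNl wformNr opprK. Qed.

Lemma q_chord x y : sf x -> sf y -> q x y = 1 - rho / 2 * chord x y.
Proof.
move=> sx sy; have h := q_horizontal _ (x - y) (space_form_sub_horizontal x y sx sy).
move: h; rewrite -/(chord x y) !wformE (wformC _ _ y x).
rewrite (space_form_q x sx) (space_form_q y sy) => h.
by lra.
Qed.

(** For rho < 0 the metric is Lorentzian on R^4, and only its restriction to the
tangent spaces is positive definite: tangency expresses the head coordinate of v
by its tail, and Cauchy-Schwarz for the tails gives the bound with k = x0^2. *)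
Lemma tangent_gdot_ge x v : sf x -> q x v = 0 ->
  exists2 k : R, 0 < k & tail_dot v v <= k * g v v.
Proof.
move=> sx tv; have [r0|r0|r0] := ltgtP rho 0.
- have [h hx] := sx; have {}hx := hx (ltW r0).
  exists (head_coord x ^+ 2); first by rewrite exprn_gt0.
  have := tail_dot_CS x v; move: tv h; rewrite /wform !mul1r.
  set t := tail_dot x v; set a := tail_dot x x; set b := tail_dot v v.
  set p := head_coord x; set w := head_coord v => e1 e2 cs.
  have b0 : 0 <= b by exact: tail_dot_ge0.
  have e3 : (p * w) ^+ 2 = rho ^+ 2 * t ^+ 2.
    have -> : p * w = - (rho * t) by lra.
    by rewrite sqrrN exprMn.
  have -> : p ^+ 2 * (rho^-1 * (w * w) + b) = rho * t ^+ 2 + p ^+ 2 * b.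
    rewrite mulrDr; congr (_ + _).
    transitivity (rho^-1 * (p * w) ^+ 2); first by ring.
    by rewrite e3 expr2 !mulrA mulVf ?mul1r// lt_eqF.
  have -> : p ^+ 2 = 1 - rho * a by lra.
  have : rho * (a * b) <= rho * t ^+ 2 by rewrite ler_nM2l.
  by lra.
- exists 1 => //; rewrite mul1r /wform mul1r lerDr mulr_ge0//.
    by rewrite invr_ge0 ltW.
  by rewrite -expr2 sqr_ge0.
- exists 1 => //; rewrite mul1r /wform mul1r.
  by have := tangent_horizontal x v sx tv r0 => ->; rewrite mul0r mulr0 add0r.
Qed.

Lemma tangent_gdot_ge0 x v : sf x -> q x v = 0 -> 0 <= g v v.
Proof.
move=> sx tv; have [k k0] := tangent_gdot_ge x v sx tv.
by move=> /(le_trans (tail_dot_ge0 v)); rewrite pmulr_rge0.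
Qed.

Lemma tangent_gdot_eq0 x v : sf x -> q x v = 0 -> g v v = 0 -> v = 0.
Proof.
move=> sx tv g0; have [k k0] := tangent_gdot_ge x v sx tv; rewrite g0 mulr0 => t0.
have {}t0 : tail_dot v v = 0 by apply/le_anti; rewrite t0 tail_dot_ge0.
apply: tail_dot_eq0 => //.
have [/(tangent_horizontal x v sx tv)//|r0] := eqVneq rho 0.
move: g0; rewrite /wform t0 mulr0 addr0 => /eqP.
by rewrite !mulf_eq0 invr_eq0 (negbTE r0) orbb => /eqP.
Qed.

Lemma tangent_gdot_CS x v w : sf x -> q x v = 0 -> q x w = 0 -> g w w = 1 ->
  g v w ^+ 2 <= g v v.
Proof.
move=> sx tv tw w1.
have := tangent_gdot_ge0 x (v - g v w *: w) sx.
rewrite !wformE tv tw mulr0 oppr0 addr0 (wformC _ _ w v) w1 => /(_ erefl).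
by lra.
Qed.

(** For rho < 0 this is the reversed Cauchy-Schwarz inequality 1 <= q x y for
points of the same sheet of the hyperboloid. *)
Lemma chord_ge0 x y : sf x -> sf y -> 0 <= chord x y.
Proof.
move=> sx sy; have [r0|r0|r0] := ltgtP rho 0.
- have [h hx] := sx; have [h' hy] := sy.
  have {}hx := hx (ltW r0); have {}hy := hy (ltW r0).
  have := q_chord x y sx sy; suff : 1 <= q x y.
    move=> ? e; have : rho * chord x y <= 0 by lra.
    by rewrite nmulr_rle0.
  have := tail_dot_CS x y.
  have := tail_dot_ge0 x; have := tail_dot_ge0 y; have := tail_dot_ge0 (x - y).
  have -> : tail_dot (x - y) (x - y) = tail_dot x x - 2 * tail_dot x y + tail_dot y y.
    by rewrite /tail_dot !big_ord_recl !big_ord0 !mxE; ring.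
  move: h h'; rewrite /wform mul1r.
  set a := tail_dot x x; set b := tail_dot y y; set m := tail_dot x y.
  set p := head_coord x; set w := head_coord y => e1 e2 pos b0 a0 cs.
  have [lt0|gt0] := leP (1 - rho * m) 0.
    have : 0 < p * w by rewrite mulr_gt0.
    by lra.
  suff : 1 - rho * m <= p * w by lra.
  rewrite -(@ler_pXn2r _ 2) ?nnegrE ?(ltW gt0) ?(mulr_ge0 (ltW hx) (ltW hy))//.
  rewrite exprMn; have -> : p ^+ 2 = 1 - rho * a by lra.
  have -> : w ^+ 2 = 1 - rho * b by lra.
  have : rho ^+ 2 * m ^+ 2 <= rho ^+ 2 * (a * b) by rewrite ler_wpM2l ?sqr_ge0.
  have : rho * (a - 2 * m + b) <= 0 by rewrite nmulr_rle0.
  by lra.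
- rewrite /chord /wform mul1r addr_ge0 ?tail_dot_ge0// mulr_ge0//.
    by rewrite invr_ge0 ltW.
  by rewrite -expr2 sqr_ge0.
- by rewrite /chord /wform r0 invr0 mul0r add0r mul1r tail_dot_ge0.
Qed.

(** The extreme value is attained at antipodal points of the sphere. *)
Lemma chord_le x y : sf x -> sf y -> 0 < rho -> rho * chord x y <= 4.
Proof.
move=> sx sy r0; have : 0 <= q (x + y) (x + y).
  by rewrite /wform mul1r -expr2 addr_ge0 ?sqr_ge0// mulr_ge0 ?tail_dot_ge0// ltW.
rewrite !wformE (wformC _ _ y x) (space_form_q x sx) (space_form_q y sy).
by rewrite (q_chord x y sx sy); lra.
Qed.

Lemma chord_eq0 x y : sf x -> sf y -> chord x y = 0 -> x = y.
Proof.
move=> sx sy c0; apply/eqP; rewrite -subr_eq0; apply/eqP.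
apply: (tangent_gdot_eq0 x) => //.
by rewrite !wformE (space_form_q x sx) (q_chord x y sx sy) c0; lra.
Qed.

End SpaceFormGeometry.
Arguments chord {R}.
Arguments horizontal {R}.

(** * Comparison of unit speed curves with geodesics *)

(** C and S are the cosine and sine of curvature rho: u |-> C u x + S u v is the
unit speed geodesic from x with velocity v, and phi u is the squared chord
between its points of parameters 0 and u. The last field keeps this geodesic on
the sheet x0 > 0. *)
Record jacobi_trig {R : realType} (rho : R) (C S phi : R -> R) : Prop := JacobiTrig {
  jt_derive_C : forall u : R, is_derive u 1 C (- rho * S u);
  jt_derive_S : forall u : R, is_derive u 1 S (C u);
  jt_derive_phi : forall u : R, is_derive u 1 phi (2 * S u);
  jt_C0 : C 0 = 1;
  jt_S0 : S 0 = 0;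
  jt_phi0 : phi 0 = 0;
  jt_C_gt0 : rho <= 0 -> forall u, 0 < C u
}.
Arguments jt_derive_C {R rho C S phi}.
Arguments jt_derive_S {R rho C S phi}.
Arguments jt_derive_phi {R rho C S phi}.
Arguments jt_C0 {R rho C S phi}.
Arguments jt_S0 {R rho C S phi}.
Arguments jt_phi0 {R rho C S phi}.
Arguments jt_C_gt0 {R rho C S phi}.

Section JacobiTrig.
Context {R : realType} {rho : R} {C S phi : R -> R} (trig : jacobi_trig rho C S phi).

Lemma jt_phiE u : rho * phi u = 2 * (1 - C u).
Proof.
suff : rho * phi u + 2 * C u = rho * phi 0 + 2 * C 0.
  by rewrite (jt_phi0 trig) (jt_C0 trig); lra.
apply: (@is_derive_0_is_cst _ (fun u => rho * phi u + 2 * C u) u 0) => x.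
have := is_deriveD (is_deriveZ rho (jt_derive_phi trig x))
  (is_deriveZ 2 (jt_derive_C trig x)).
by move=> /is_derive_eq; apply; rewrite /GRing.scale/=; ring.
Qed.

Lemma jt_circle u : C u ^+ 2 + rho * S u ^+ 2 = 1.
Proof.
have -> : 1 = C 0 * C 0 + rho * (S 0 * S 0).
  by rewrite (jt_S0 trig) (jt_C0 trig); ring.
rewrite !expr2.
apply: (@is_derive_0_is_cst _ (fun u => C u * C u + rho * (S u * S u)) u 0) => x.
have dC := jt_derive_C trig x; have dS := jt_derive_S trig x.
have := is_deriveD (is_derive_mul dC dC)
  (is_deriveZ rho (is_derive_mul dS dS)).
by move=> /is_derive_eq; apply; rewrite /GRing.scale/=; ring.
Qed.

Lemma jt_sqrS u : 2 * S u ^+ 2 = phi u * (1 + C u).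
Proof.
suff : 2 * (S u * S u) - phi u * (1 + C u) = 2 * (S 0 * S 0) - phi 0 * (1 + C 0).
  by rewrite (jt_S0 trig) (jt_phi0 trig) expr2; lra.
apply: (@is_derive_0_is_cst _ (fun u => 2 * (S u * S u) - phi u * (1 + C u)) u 0) => x.
have dC := jt_derive_C trig x; have dS := jt_derive_S trig x.
have dp := jt_derive_phi trig x.
have d1C : is_derive x 1 (fun u => 1 + C u) (- rho * S x).
  by have /is_derive_eq := is_deriveD (is_derive_cst (1 : R) x 1) dC;
    apply; rewrite add0r.
have := is_deriveB (is_deriveZ 2 (is_derive_mul dS dS))
  (is_derive_mul dp d1C).
move=> /is_derive_eq; apply; rewrite /GRing.scale/=.
have := jt_phiE x => e.
by transitivity (S x * (2 * C x - 2 + rho * phi x)); [ring|rewrite e; ring].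
Qed.

(** Here f stands for the squared chord from the starting point of a unit speed
curve, and the bound on df for the Cauchy-Schwarz inequality, which is an
equality for phi. The quotient h = (phi - f) / S is nondecreasing: its
derivative has numerator phi + f C - df S, and
(phi + f C)^2 - (4 f - rho f^2) S^2 = (phi - f)^2. As phi - f vanishes to second
order at 0 while S vanishes to first order, h starts from 0. *)
Lemma chord_comparison (L : R) (f df : R -> R) :
  0 < L -> (forall u, 0 < u <= L -> 0 < S u) ->
  (forall u : R, is_derive u 1 f (df u)) -> f 0 = 0 ->
  (forall u, 0 <= f u) ->
  (forall u, df u ^+ 2 <= 4 * f u - rho * f u ^+ 2) ->
  f L <= phi L.
Proof.
move=> L0 S_gt0 dfE f0 f_ge0 df_le.
pose k u := phi u - f u.
have dk (u : R) : is_derive u 1 k (2 * S u - df u).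
  exact: is_deriveB (jt_derive_phi trig u) (dfE u).
have dS := jt_derive_S trig.
pose h u := k u / S u.
have dh (u : R) : 0 < u <= L ->
    is_derive u 1 h (((2 * S u - df u) * S u - k u * C u) / S u ^+ 2).
  move=> uL; have Su := S_gt0 u uL.
  have dV := is_deriveV (lt0r_neq0 Su) (dS u).
  have := is_derive_mul (dk u) dV.
  move=> /is_derive_eq; apply; rewrite /GRing.scale/=.
  by field; rewrite lt0r_neq0.
have dh_ge0 u : 0 < u <= L -> 0 <= ((2 * S u - df u) * S u - k u * C u) / S u ^+ 2.
  move=> uL; apply: divr_ge0; last exact: sqr_ge0.
  have -> : (2 * S u - df u) * S u - k u * C u = phi u + f u * C u - df u * S u.
    by have := jt_sqrS u; rewrite /k => e; transitivity
      (2 * S u ^+ 2 - phi u * C u + f u * C u - df u * S u); [ring|rewrite e; ring].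
  rewrite subr_ge0; have Su := S_gt0 u uL; have e1 := jt_circle u.
  have e2 := jt_phiE u; have e3 := jt_sqrS u.
  have fu := f_ge0 u; have du := df_le u.
  have S2 : 0 < S u ^+ 2 by rewrite exprn_gt0.
  (* The sign of phi + f C is only in question past the equator of a sphere,
     where the bound rho f <= 4 enters. *)
  have pos : 0 <= phi u + f u * C u.
    have [r0|r0] := leP rho 0.
      have C0 := jt_C_gt0 trig r0 u.
      have C1 : 0 < 1 + C u by lra.
      have : 0 < phi u * (1 + C u) by rewrite -e3 mulr_gt0.
      by rewrite pmulr_lgt0// => p0; rewrite addr_ge0 ?mulr_ge0 ?(ltW p0) ?(ltW C0).
    have rS : 0 < rho * S u ^+ 2 by rewrite mulr_gt0.
    have C1 : C u ^+ 2 <= 1 by lra.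
    have CN1 : -1 <= C u by nra.
    have CL1 : C u <= 1 by nra.
    have phi_ge0 : 0 <= phi u by rewrite -(pmulr_rge0 _ r0) e2; lra.
    have [C0|C0] := leP 0 (C u); first by rewrite addr_ge0 ?mulr_ge0.
    have rf : rho * f u <= 4.
      rewrite leNgt; apply/negP => rf4.
      have f0' : 0 < f u by rewrite -(pmulr_rgt0 _ r0); lra.
      have : f u * (4 - rho * f u) < 0 by rewrite pmulr_rlt0// subr_lt0.
      have : 0 <= df u ^+ 2 by exact: sqr_ge0.
      by lra.
    rewrite -(pmulr_rge0 _ r0) mulrDr e2 mulrA.
    have : 4 * C u <= rho * f u * C u by rewrite ler_wnM2r// ltW.
    by lra.
  apply: le_trans (ler_norm _) _.
  rewrite -(@ler_pXn2r _ 2) ?nnegrE// real_normK ?num_real// exprMn.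
  apply: (@le_trans _ _ ((4 * f u - rho * f u ^+ 2) * S u ^+ 2)).
    by rewrite ler_wpM2r ?sqr_ge0.
  rewrite -subr_ge0 (_ : _ - _ = (phi u - f u) ^+ 2) ?sqr_ge0//.
  transitivity (phi u ^+ 2 + 2 * phi u * f u * C u +
    f u ^+ 2 * (C u ^+ 2 + rho * S u ^+ 2) - 2 * f u * (2 * S u ^+ 2)); first by ring.
  by rewrite e1 e3; ring.
have h_le u : 0 < u <= L -> h u <= h L.
  move=> /andP[u0 uL].
  have sub z : z \in `]u, L[ -> 0 < z <= L.
    by rewrite in_itv/= => /andP[uz zL]; rewrite (lt_trans u0 uz) ltW.
  apply: (@ger0_derive1_le_cc _ h u L) => //.
  - by move=> z /sub/dh[].
  - by move=> z /sub zL; rewrite (is_derive_derive1 (dh z zL)) dh_ge0.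
  - apply: derivable_within_continuous => z; rewrite in_itv/= => /andP[uz zL].
    by have [] := dh z; rewrite ?zL ?(lt_le_trans u0 uz).
  - by rewrite in_itv/= lexx.
  - by rewrite in_itv/= lexx uL.
(* If h L = m < 0, then k <= m S on ]0, L]; but k - m S vanishes at 0 with
   derivative - m > 0, so it is positive just after 0. *)
rewrite -subr_ge0 -/(k L); apply/negPn/negP; rewrite -ltNge => kL.
have SL : 0 < S L by apply: S_gt0; rewrite L0 lexx.
pose m := h L; have m0 : m < 0 by rewrite /m /h pmulr_llt0 ?invr_gt0.
pose w u := k u - m * S u.
have dw : is_derive (0 : R) 1 w (- m).
  have := is_deriveB (dk 0) (is_deriveZ m (dS 0)).
  move=> /is_derive_eq; apply; rewrite (jt_S0 trig) (jt_C0 trig).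
  have := df_le 0; rewrite f0 => e.
  have : df 0 ^+ 2 = 0 by apply/le_anti; rewrite sqr_ge0 andbT; lra.
  by move=> /eqP; rewrite sqrf_eq0 => /eqP ->; rewrite /GRing.scale/=; ring.
have w_le0 u : 0 < u <= L -> w u <= 0.
  move=> uL; rewrite /w subr_le0 -ler_pdivrMr ?S_gt0//; exact: h_le.
have [dw1 dw2] := dw.
have /cvgr_gt/(_ 0) : (fun z => z^-1 *: ((w \o shift 0) (z *: 1) - w 0)) @ 0^' --> - m.
  by rewrite -dw2; exact: dw1.
rewrite oppr_gt0 => /(_ m0) [e /= e0 He].
pose z := Num.min (e / 2) L.
have z0 : 0 < z by rewrite lt_min L0 divr_gt0.
have zL : z <= L by rewrite ge_min lexx orbT.
have ze : z < e by rewrite gt_min; apply/orP; left; lra.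
have := He z; rewrite /= sub0r normrN (gtr0_norm z0) => /(_ ze (lt0r_neq0 z0)).
have -> : w 0 = 0.
  by rewrite /w /k (jt_phi0 trig) (jt_S0 trig) f0 !subr0 mulr0 subr0.
rewrite subr0 addr0 /GRing.scale/= mulr1 pmulr_rgt0 ?invr_gt0//.
by rewrite ltNge w_le0// z0.
Qed.

End JacobiTrig.

(** * The three geometries *)

Section JacobiTrigExists.
Context {R : realType}.
Implicit Types (rho D : R).

Lemma is_derive_scale_arg (r : R) (f df : R -> R) (u : R) :
  (forall z : R, is_derive z 1 f (df z)) ->
  is_derive u 1 (fun z => f (r * z)) (r * df (r * u)).
Proof.
move=> fd; have dr : is_derive u 1 (fun z => r * z) r.
  have := is_deriveZ r (is_derive_id u (1 : R)).
  by move=> /is_derive_eq; apply; rewrite /GRing.scale/= mulr1.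
have := @is_derive1_comp _ f (fun z => r * z) u _ _ (fd (r * u)) dr.
by move=> /is_derive_eq; apply; rewrite mulrC.
Qed.

Lemma jacobi_trig_spherical rho : 0 < rho ->
  jacobi_trig rho (fun u => cos (Num.sqrt rho * u))
    (fun u => (Num.sqrt rho)^-1 * sin (Num.sqrt rho * u))
    (fun u => 2 * rho^-1 * (1 - cos (Num.sqrt rho * u))).
Proof.
move=> r0; set r := Num.sqrt rho.
have rr : rho = r * r by rewrite -expr2 sqr_sqrtr// ltW.
have rN0 : r != 0 by rewrite lt0r_neq0// sqrtr_gt0.
have dcos (u : R) : is_derive u 1 (fun z => cos (r * z)) (r * - sin (r * u)).
  by apply: is_derive_scale_arg => z; exact: is_derive_cos.
have dsin (u : R) : is_derive u 1 (fun z => sin (r * z)) (r * cos (r * u)).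
  by apply: is_derive_scale_arg => z; exact: is_derive_sin.
split => [u|u|u||||].
- by apply: is_derive_eq (dcos u) _; rewrite {1}rr; field.
- apply: is_derive_eq (is_deriveZ r^-1 (dsin u)) _.
  by rewrite /GRing.scale/=; field.
- have d1 := is_deriveB (is_derive_cst (1 : R) u 1) (dcos u).
  apply: is_derive_eq (is_deriveZ (2 * rho^-1) d1) _.
  by rewrite /GRing.scale/= rr; field.
- by rewrite mulr0 cos0.
- by rewrite mulr0 sin0 mulr0.
- by rewrite mulr0 cos0 subrr mulr0.
- by rewrite leNgt r0.
Qed.

Lemma jacobi_trig_hyperbolic rho : rho < 0 ->
  let r := Num.sqrt (- rho) in
  let ch u := (expR (r * u) + expR (- r * u)) / 2 in
  jacobi_trig rho ch
    (fun u => (2 * r)^-1 * (expR (r * u) - expR (- r * u)))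
    (fun u => 2 * rho^-1 * (1 - ch u)).
Proof.
move=> r0 r ch.
have rr : rho = - (r * r) by rewrite -expr2 sqr_sqrtr ?opprK// oppr_ge0 ltW.
have rN0 : r != 0 by rewrite lt0r_neq0// sqrtr_gt0 oppr_gt0.
have dexp (k u : R) : is_derive u 1 (fun z => expR (k * z)) (k * expR (k * u)).
  by apply: is_derive_scale_arg => z; exact: is_derive_expR.
have dch (u : R) : is_derive u 1 ch (2^-1 * (r * expR (r * u) + - r * expR (- r * u))).
  have -> : ch = 2^-1 \*: ((fun z => expR (r * z)) + (fun z => expR (- r * z))).
    by apply/funext => z; rewrite /ch mulrC.
  exact: is_deriveZ.
split => [u|u|u||||].
- by apply: is_derive_eq (dch u) _; rewrite {1}rr; field.
- apply: is_derive_eq (is_deriveZ (2 * r)^-1 (is_deriveB (dexp r u) (dexp (- r) u))) _.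
  by rewrite /GRing.scale/= /ch; field.
- have d1 := is_deriveB (is_derive_cst (1 : R) u 1) (dch u).
  apply: is_derive_eq (is_deriveZ (2 * rho^-1) d1) _.
  by rewrite /GRing.scale/= rr; field.
- by rewrite /ch !mulr0 expR0; field.
- by rewrite !mulr0 subrr mulr0.
- by rewrite /ch !mulr0 expR0; field; rewrite lt_eqF.
- by move=> _ u; rewrite divr_gt0// addr_gt0// expR_gt0.
Qed.

Lemma jacobi_trig_flat : jacobi_trig (0 : R) (fun=> 1) id (fun u => u * u).
Proof.
split => [u|u|u||||]//.
- by apply: is_derive_eq (is_derive_cst (1 : R) u 1) _; rewrite oppr0 mul0r.
- exact: is_derive_id.
- have d := is_derive_id u (1 : R).
  by apply: is_derive_eq (is_derive_mul d d) _ => /=; ring.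
- by rewrite mul0r.
Qed.

(** The bound rho * D < 4 leaves out the antipodal points of a sphere, where S
vanishes and the geodesic is not determined by its end point. *)
Lemma jacobi_trig_exists rho D : 0 < D -> rho * D < 4 ->
  exists C S phi, jacobi_trig rho C S phi /\
    exists L : R, [/\ 0 < L, phi L = D & forall u, 0 < u <= L -> 0 < S u].
Proof.
move=> D0 rD; have [r0|r0|r0] := ltgtP rho 0.
- set r := Num.sqrt (- rho).
  eexists; eexists; eexists; split; first exact: (jacobi_trig_hyperbolic rho r0).
  rewrite -/r.
  have rp : 0 < r by rewrite sqrtr_gt0 oppr_gt0.
  pose c := 1 - rho * D / 2.
  have rD0 : rho * D < 0 by rewrite nmulr_rlt0.
  have c1 : 1 < c by rewrite /c; lra.
  pose s := Num.sqrt (c ^+ 2 - 1).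
  have ss : s ^+ 2 = c ^+ 2 - 1 by rewrite sqr_sqrtr// subr_ge0 exprn_ege1// ltW.
  have s0 : 0 <= s by exact: sqrtr_ge0.
  have cs1 : 1 < c + s by lra.
  have cs0 : 0 < c + s by lra.
  exists (ln (c + s) / r); split.
  + by rewrite divr_gt0// ln_gt0.
  + have rL : r * (ln (c + s) / r) = ln (c + s) by rewrite mulrC divfK ?lt0r_neq0.
    rewrite mulNr rL expRN lnK ?posrE//.
    have -> : (c + s)^-1 = c - s.
      apply: (mulfI (lt0r_neq0 cs0)); rewrite divff ?lt0r_neq0//.
      by transitivity (c ^+ 2 - s ^+ 2); [rewrite ss; ring|ring].
    by rewrite /c; field; rewrite lt_eqF.
  + move=> u /andP[u0 _]; rewrite mulr_gt0 ?invr_gt0 ?mulr_gt0//.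
    rewrite subr_gt0 ltr_expR mulNr gtrN//.
      by rewrite mulr_gt0.
- set r := Num.sqrt rho.
  eexists; eexists; eexists; split; first exact: (jacobi_trig_spherical rho r0).
  rewrite -/r.
  have rp : 0 < r by rewrite sqrtr_gt0.
  pose c := 1 - rho * D / 2.
  have rD0 : 0 < rho * D by rewrite mulr_gt0.
  have c1 : -1 < c < 1 by rewrite /c; apply/andP; split; lra.
  have [cl cu] := andP c1.
  exists (acos c / r); split.
  + by rewrite divr_gt0// acos_gt0// cu ltW.
  + have rL : r * (acos c / r) = acos c by rewrite mulrC divfK ?lt0r_neq0.
    rewrite rL acosK ?in_itv/= ?(ltW cl) ?(ltW cu)//.
    by rewrite /c; field; rewrite lt0r_neq0.
  + move=> u /andP[u0 uL]; rewrite mulr_gt0 ?invr_gt0//.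
    apply: sin_gt0_pi; rewrite mulr_gt0//=.
    rewrite ler_pdivlMr// mulrC in uL.
    by rewrite (le_lt_trans uL)// acos_ltpi// cl ltW.
- subst rho; exists (fun=> 1), id, (fun u => u * u); split; first exact: jacobi_trig_flat.
  exists (Num.sqrt D); split.
  + by rewrite sqrtr_gt0.
  + by rewrite -expr2 sqr_sqrtr// ltW.
  + by move=> u /andP[].
Qed.

End JacobiTrigExists.

(** * Isometric maps do not increase chords *)

Section IsometriesPreserveChords.
Context {R : realType}.
Variable rho : R.
Implicit Types (v w x y : 'rV[R]_4) (f : 'rV[R]_4 -> 'rV[R]_4).
Local Notation g := (wform rho^-1 1).
Local Notation q := (wform 1 rho).
Local Notation sf := (space_form rho).

Section Geodesic.
Context {C S phi : R -> R} (trig : jacobi_trig rho C S phi).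

Lemma is_derive_geodesic x v (u : R) :
  is_derive u 1 (fun z => C z *: x + S z *: v) (C u *: v + S u *: (- rho *: x)).
Proof.
have dC := jt_derive_C trig u; have dS := jt_derive_S trig u.
have := is_deriveD (is_derive_scalel x dC) (is_derive_scalel v dS).
by move=> /is_derive_eq; apply; rewrite addrC scalerA mulrC.
Qed.

(** The span of C and S is stable under derivation, so every iterated derivative
is again of the form C u x' + S u v'. *)
Lemma geodesic_smooth x v : smooth (fun u => C u *: x + S u *: v).
Proof.
suff h k : exists x' v', derive1n k (fun u => C u *: x + S u *: v) =
    (fun u => C u *: x' + S u *: v').
  move=> k u _; have [x' [v' ->]] := h k.
  by case: (is_derive_geodesic x' v' u).
elim: k => [|k [x' [v' IH]]]; first by exists x, v.
exists v', (- rho *: x'); rewrite derive1nS IH; apply/funext => u.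
exact/is_derive_derive1/is_derive_geodesic.
Qed.

Lemma geodesic_space_form x v u : sf x -> q x v = 0 -> g v v = 1 ->
  sf (C u *: x + S u *: v).
Proof.
move=> sx tv v1; have e := jt_circle trig u.
have hv := tangent_horizontal rho x v sx tv.
have qv : q v v = rho by rewrite (q_horizontal _ _ _ hv) v1 mulr1.
split.
  have : q (C u *: x + S u *: v) (C u *: x + S u *: v) = 1.
    rewrite !wformE (wformC _ _ v x) tv qv (space_form_q _ x sx).
    by transitivity (C u ^+ 2 + rho * S u ^+ 2); [ring|].
  by rewrite /wform mul1r expr2.
move=> r0; have C0 := jt_C_gt0 trig r0 u.
have [hx0 x0] := sx; have {}x0 := x0 r0.
rewrite /head_coord !mxE -/(head_coord x) -/(head_coord v).
move: v1 e tv hv hx0 qv; rewrite /wform !mul1r.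
set p := head_coord x; set w := head_coord v.
set a := tail_dot x x; set b := tail_dot v v; set t := tail_dot x v.
move=> v1 e tv hv hx0 qv.
have [r1|r1] := eqVneq rho 0; first by rewrite /w hv// mulr0 addr0 mulr_gt0.
have cs := tail_dot_CS x v; rewrite -/a -/b -/t in cs.
have a0 : 0 <= a := tail_dot_ge0 x.
have {}r1 : rho < 0 by rewrite lt_neqAle r1.
have wle : w ^+ 2 <= - rho * (p ^+ 2 - 1).
  have pw : (p * w) ^+ 2 = rho ^+ 2 * t ^+ 2.
    have -> : p * w = - (rho * t) by lra.
    by rewrite sqrrN exprMn.
  have : rho ^+ 2 * t ^+ 2 <= (rho * a) * (rho * b).
    have -> : (rho * a) * (rho * b) = rho ^+ 2 * (a * b) by ring.
    by rewrite ler_wpM2l ?sqr_ge0.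
  rewrite -pw; have -> : rho * a = 1 - p ^+ 2 by lra.
  have -> : rho * b = rho - w ^+ 2 by rewrite expr2; lra.
  by lra.
have : (S u * w) ^+ 2 < (C u * p) ^+ 2.
  have : S u ^+ 2 * w ^+ 2 <= S u ^+ 2 * (- rho * (p ^+ 2 - 1)).
    by rewrite ler_wpM2l ?sqr_ge0.
  have p2 : 1 <= p ^+ 2.
    by have ra : rho * a <= 0; [rewrite nmulr_rle0|lra].
  have C1 : 0 < C u ^+ 2 by rewrite exprn_gt0.
  have -> : S u ^+ 2 * (- rho * (p ^+ 2 - 1)) = (C u ^+ 2 - 1) * (p ^+ 2 - 1).
    have -> : C u ^+ 2 - 1 = - rho * S u ^+ 2 by lra.
    by ring.
  rewrite !exprMn; lra.
have Cp : 0 < C u * p by rewrite mulr_gt0.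
rewrite -(real_normK (num_real (S u * w))) ltr_pXn2r ?nnegrE ?(ltW Cp)//.
rewrite ltr_norml => /andP[]; lra.
Qed.
End Geodesic.

Lemma space_form_curve_tangent (e : R -> 'rV[R]_4) u : smooth e ->
  (forall z, sf (e z)) -> q (e u) (derive1 e u) = 0.
Proof.
move=> se sfe; have de := smooth_is_derive1 u se.
have := wform_cst_derive (k := 1) de de (fun z => space_form_q _ _ (sfe z)).
by rewrite wformC; lra.
Qed.

(** Only the part of e u - e 0 tangent at e u pairs with the velocity, and with
F the squared chord this part has squared norm F - rho F^2 / 4. *)
Lemma unit_speed_chord_derivative (e : R -> 'rV[R]_4) u : smooth e ->
  (forall z, sf (e z)) -> g (derive1 e u) (derive1 e u) = 1 ->
  (2 * g (derive1 e u) (e u - e 0)) ^+ 2 <=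
    4 * chord rho (e u) (e 0) - rho * chord rho (e u) (e 0) ^+ 2.
Proof.
move=> se sfe e1; have te := space_form_curve_tangent e u se sfe.
set F := chord rho (e u) (e 0).
have qF : q (e u) (e u - e 0) = rho / 2 * F.
  by rewrite !wformE (space_form_q _ _ (sfe u)) (q_chord rho)// -/F; ring.
pose z := (e u - e 0) - (rho / 2 * F) *: e u.
have tz : q (e u) z = 0.
  by rewrite /z wformDr qF wformNr wformZr (space_form_q _ _ (sfe u)); ring.
have hd := space_form_sub_horizontal rho _ _ (sfe u) (sfe 0).
have he := tangent_horizontal rho _ _ (sfe u) te.
have ge : g (derive1 e u) z = g (derive1 e u) (e u - e 0).
  rewrite /z wformDr wformNr wformZr.
  have : rho * g (derive1 e u) (e u) = 0 by rewrite wformC -q_horizontal.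
  by move=> h0; transitivity (g (derive1 e u) (e u - e 0)
    - F / 2 * (rho * g (derive1 e u) (e u))); [ring|rewrite h0; ring].
have gz : g z z = F - rho * F ^+ 2 / 4.
  have e3 : rho * g (e u) (e u - e 0) = rho / 2 * F.
    by rewrite -q_horizontal.
  have e2 : rho * rho * g (e u) (e u) = rho by exact: rho2_gdot.
  rewrite /z wformDl wformDr -/(chord rho _ _) -/F wformDr !wformNl !wformNr !wformZl !wformZr.
  rewrite (wformC _ _ (e u - e 0) (e u)).
  transitivity (F - F * (rho * g (e u) (e u - e 0))
     + F ^+ 2 / 4 * (rho * rho * g (e u) (e u))); first by field.
  by rewrite e3 e2; field.
have := tangent_gdot_CS rho _ _ _ (sfe u) tz te e1.
by rewrite wformC ge gz exprMn; lra.
Qed.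

(** The image of the unit speed geodesic from x to y is a unit speed curve from
f x to f y, to which [chord_comparison] applies. When x and y are antipodal the
right-hand side is already the largest chord. *)
Lemma isometric_map_chord_le f x y : isometric_map rho f -> sf x -> sf y ->
  chord rho (f x) (f y) <= chord rho x y.
Proof.
move=> [sff isof] sx sy; have sfx := sff _ sx; have sfy := sff _ sy.
have [c0|cN0] := eqVneq (chord rho x y) 0.
  by rewrite c0 (chord_eq0 rho x y sx sy c0) /chord subrr wform0l.
have cxy : 0 < chord rho x y by rewrite lt_neqAle eq_sym cN0 chord_ge0.
have [c4|c4] := leP 4 (rho * chord rho x y).
  have r0 : 0 < rho by rewrite -(pmulr_lgt0 _ cxy); lra.
  by rewrite -(ler_pM2l r0); apply: le_trans c4; exact: chord_le.
have [C [S [phi [trig [L [L0 phiL S_gt0]]]]]] := jacobi_trig_exists rho _ cxy c4.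
have SL : 0 < S L by apply: S_gt0; rewrite L0 lexx.
have CL : C L = q x y.
  by rewrite (q_chord rho x y)//; have := jt_phiE trig L; rewrite phiL; lra.
pose w := y - C L *: x; pose v := (S L)^-1 *: w.
have tw : q x w = 0 by rewrite !wformE (space_form_q _ x sx) -CL mulr1 subrr.
have tv : q x v = 0 by rewrite wformZr tw mulr0.
have w2 : g w w = S L ^+ 2.
  have hw := tangent_horizontal rho x w sx tw.
  have [r0|r0] := eqVneq rho 0.
    have CL1 : C L = 1 by have := jt_phiE trig L; rewrite r0 mul0r; lra.
    have := jt_sqrS trig L; rewrite /w CL1 scale1r phiL chordC /chord.
    lra.
  apply: (mulfI r0); rewrite -(q_horizontal _ _ _ hw) /w !wformE.
  rewrite (wformC _ _ y x) (space_form_q _ x sx) (space_form_q _ y sy) -CL.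
  by have := jt_circle trig L; lra.
have v1 : g v v = 1.
  by rewrite wformZl wformZr w2; field; rewrite lt0r_neq0.
have Sv : S L *: v = w by rewrite /v scalerA divff ?lt0r_neq0// scale1r.
clearbody v.
pose c : R -> 'rV[R]_4 := fun u => C u *: x + S u *: v.
have sc : smooth c by exact: (geodesic_smooth trig x v).
have sfc u : sf (c u) by exact: (geodesic_space_form trig x v u sx tv v1).
have c0 : c 0 = x.
  by rewrite /c (jt_C0 trig) (jt_S0 trig) scale1r scale0r addr0.
have cL : c L = y by rewrite /c Sv addrC subrK.
pose e := f \o c.
have [se speed] := isof c sc sfc.
have sfe u : sf (e u) by exact: sff.
have de u := smooth_is_derive1 u se.
have e1 u : g (derive1 e u) (derive1 e u) = 1.
  rewrite -gdotE speed gdotE.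
  rewrite (is_derive_derive1 (is_derive_geodesic trig x v u)).
  rewrite !wformE v1 (wformC _ _ v x).
  have hv := tangent_horizontal rho x v sx tv.
  have e1 : rho * g x v = 0 by rewrite -(q_horizontal _ _ _ hv).
  have e2 : rho * rho * g x x = rho by exact: rho2_gdot.
  transitivity (C u ^+ 2 - 2 * C u * S u * (rho * g x v)
    + S u ^+ 2 * (rho * rho * g x x)); first by ring.
  by rewrite e1 e2 -(jt_circle trig u); ring.
have eL : e L = f y by rewrite /e /= cL.
have e0 : e 0 = f x by rewrite /e /= c0.
rewrite chordC -phiL -eL -e0.
apply: (chord_comparison trig L (fun u => chord rho (e u) (e 0))
  (fun u => 2 * g (derive1 e u) (e u - e 0))) => //.
- move=> u; have d1 := is_deriveB (de u) (is_derive_cst (e 0) u (1 : R)).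
  have := is_derive_wform rho^-1 1 d1 d1.
  by move=> /is_derive_eq; apply; rewrite subr0 (wformC _ _ _ (derive1 e u)) mulr2n mulrDl !mul1r.
- by rewrite /chord subrr wform0l.
- by move=> u; exact: chord_ge0.
by move=> u; exact: unit_speed_chord_derivative.
Qed.
End IsometriesPreserveChords.

(** * Chord-preserving maps are linear *)

Section LinearExtension.
Context {R : realType}.
Variable rho : R.
Implicit Types (v w x y z : 'rV[R]_4) (f : 'rV[R]_4 -> 'rV[R]_4).
Local Notation g := (wform rho^-1 1).
Local Notation q := (wform 1 rho).
Local Notation sf := (space_form rho).

(** The rows are the point b0 = (1, 0, 0, 0) and the points a b0 + r e_i for
i = 1, 2, 3. They span R^4, and lie on the space form when a^2 + rho r^2 = 1
and a is positive in the case rho <= 0. *)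
Definition tetrahedron (a r : R) : 'M[R]_4 :=
  \matrix_(i, j) (if i == ord0 then (j == ord0)%:R
                  else a * (j == ord0)%:R + r * (i == j)%:R).

Lemma tetrahedron_unit a r : 0 < r -> tetrahedron a r \in unitmx.
Proof.
move=> r0; rewrite unitmxE det_trig.
  rewrite unitfE; apply/prodf_neq0 => i _; rewrite mxE eqxx.
  by case: (eqVneq i ord0) => [_|_]/=; rewrite ?oner_eq0// mulr0 add0r mulr1 lt0r_neq0.
apply/is_trig_mxP => i j ij; rewrite mxE.
have -> : (j == ord0) = false by rewrite -val_eqE/= gtn_eqF// (leq_ltn_trans _ ij).
have -> : (i == j) = false by rewrite -val_eqE/= ltn_eqF.
by rewrite !mulr0 addr0 if_same.
Qed.

Lemma head_tetrahedron a r i :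
  head_coord (row i (tetrahedron a r)) = if i == ord0 then 1 else a.
Proof.
rewrite /head_coord !mxE eqxx; case: (eqVneq i ord0) => //= iN0.
by rewrite mulr1 mulr0 addr0.
Qed.

Lemma tail_dot_tetrahedron0 a r z : tail_dot z (row ord0 (tetrahedron a r)) = 0.
Proof. by apply: big1 => k _; rewrite 2!mxE eqxx lift_eqF mulr0. Qed.

Lemma tetrahedron_lift a r (k i : 'I_3) :
  tetrahedron a r (lift ord0 k) (lift ord0 i) = r * (k == i)%:R.
Proof.
by rewrite mxE !lift_eqF mulr0 add0r (inj_eq (@lift_inj _ (@ord0 3))).
Qed.

Lemma tail_dot_tetrahedron a r z (k : 'I_3) :
  tail_dot z (row (lift ord0 k) (tetrahedron a r)) = r * z ord0 (lift ord0 k).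
Proof.
rewrite /tail_dot (bigD1 k)//= mxE tetrahedron_lift eqxx mulr1 big1.
  by rewrite addr0 mulrC.
by move=> i ik; rewrite mxE tetrahedron_lift eq_sym (negbTE ik) !mulr0.
Qed.

Lemma tetrahedron_exists : exists a r : R,
  0 < r /\ forall i, sf (row i (tetrahedron a r)).
Proof.
pose s := 1 + `|rho|; have s0 : 0 < s by rewrite ltr_wpDr.
pose r := (Num.sqrt s)^-1; pose a := Num.sqrt (1 - rho / s).
have rr : r ^+ 2 = s^-1 by rewrite exprVn sqr_sqrtr// ltW.
have rs : rho / s <= 1.
  by rewrite ler_pdivrMr// mul1r /s; have := ler_norm rho; lra.
have aa : a ^+ 2 = 1 - rho / s by rewrite sqr_sqrtr// subr_ge0.
exists a, r; split; first by rewrite invr_gt0 sqrtr_gt0.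
move=> i; have [->|] := eqVneq i ord0.
  by split; rewrite head_tetrahedron eqxx// tail_dot_tetrahedron0; ring.
rewrite eq_sym => /unlift_some[k -> _]; split; rewrite head_tetrahedron.
  rewrite tail_dot_tetrahedron mxE tetrahedron_lift eqxx mulr1 -expr2 lift_eqF.
  by rewrite aa rr; ring.
move=> rho0; rewrite lift_eqF sqrtr_gt0 subr_gt0.
by rewrite (le_lt_trans _ ltr01)// mulr_le0_ge0// invr_ge0 ltW.
Qed.

(** Differences of points are needed because for rho = 0 the form q only reads
the head coordinate. *)
Lemma space_form_total z : (forall y, sf y -> q z y = 0) ->
  (forall y y', sf y -> sf y' -> g z (y - y') = 0) -> z = 0.
Proof.
move=> qz gz; have [a [r [r0 sT]]] := tetrahedron_exists.
have hz : head_coord z = 0.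
  have := qz _ (sT ord0).
  by rewrite /wform head_tetrahedron tail_dot_tetrahedron0 !mul1r mulr1 mulr0 addr0.
apply/rowP => j; rewrite mxE; have [->//|] := eqVneq j ord0.
rewrite eq_sym => /unlift_some[k -> _].
have := gz _ _ (sT (lift ord0 k)) (sT ord0).
rewrite wformDr wformNr /wform hz tail_dot_tetrahedron0 tail_dot_tetrahedron.
rewrite !mul0r !mulr0 !add0r !mul1r subr0 => /eqP.
by rewrite mulf_eq0 (gt_eqF r0) => /eqP.
Qed.

Definition preserves_chords f := (forall x, sf x -> sf (f x)) /\
  (forall x y, sf x -> sf y -> chord rho (f x) (f y) = chord rho x y).

(** The difference of the two sides is orthogonal, for q and for g, to everything
that [space_form_total] tests, because f preserves chords and reaches every
point. For g, chords give g (f w) (f y - f y') only up to a constant k that does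
not depend on w; its total contribution is k (1 - sum b), which vanishes because
k = 0 when rho <> 0 and sum b = 1 when rho = 0. *)
Lemma preserves_chords_comb f f' (I : finType) (b : I -> R) (p : I -> 'rV[R]_4) x :
  preserves_chords f -> (forall y, sf y -> sf (f' y)) ->
  (forall y, sf y -> f (f' y) = y) ->
  (forall i, sf (p i)) -> sf x -> x = \sum_i b i *: p i ->
  f x = \sum_i b i *: f (p i).
Proof.
move=> [sff cf] sff' ff' sp sx xE.
have qf y y' : sf y -> sf y' -> q (f y) (f y') = q y y'.
  by move=> sy sy'; rewrite (q_chord rho _ _ (sff _ sy) (sff _ sy')) cf// -q_chord.
apply/eqP; rewrite -subr_eq0; apply/eqP; apply: space_form_total => [y sy|y y' sy sy'].
  rewrite -(ff' y sy); move: (f' y) (sff' y sy) => {sy}y sy.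
  rewrite wformDl wformNl wform_suml qf//.
  under eq_bigr do rewrite wformZl qf// -wformZl.
  by rewrite -wform_suml -xE subrr.
rewrite -(ff' y sy) -(ff' y' sy').
move: (f' y) (sff' y sy) (f' y') (sff' y' sy') => {sy sy'}y sy {}y' sy'.
pose k := (g (f y) (f y) - g (f y') (f y') - g y y + g y' y') / 2.
have gf w : sf w -> g (f w) (f y - f y') = g w (y - y') + k.
  move=> sw; have := cf w y sw sy; have := cf w y' sw sy'.
  rewrite /chord !wformE !(wformC _ _ _ (f w)) !(wformC _ _ _ w) /k; lra.
have k0 : k * (1 - \sum_i b i) = 0.
  have [r0|rN0] := eqVneq rho 0.
    suff -> : \sum_i b i = 1 by rewrite subrr mulr0.
    rewrite -(space_form_head_eq1 rho x sx r0) xE /head_coord summxE.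
    apply: eq_bigr => i _; rewrite mxE.
    by have := space_form_head_eq1 rho _ (sp i) r0; rewrite /head_coord => ->; rewrite mulr1.
  suff -> : k = 0 by rewrite mul0r.
  have gs w : sf w -> g w w = rho^-1.
    move=> sw; apply: (mulfI rN0); rewrite divff//.
    have hw : horizontal rho w by move=> e; rewrite e eqxx in rN0.
    by rewrite -q_horizontal// space_form_q.
  by rewrite /k !gs//; [ring|exact: sff|exact: sff].
rewrite wformDl wformNl wform_suml gf//.
under eq_bigr do rewrite wformZl gf// mulrDr -wformZl.
rewrite big_split/= -wform_suml -xE -mulr_suml; lra.
Qed.

Lemma preserves_chords_linear f f' :
  preserves_chords f -> (forall y, sf y -> sf (f' y)) ->
  (forall y, sf y -> f (f' y) = y) ->
  forall B : 'M[R]_4, B \in unitmx -> (forall i, sf (row i B)) ->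
  forall x, sf x -> f x = x *m (invmx B *m \matrix_i f (row i B)).
Proof.
move=> pf sff' ff' B uB sB x sx.
rewrite (preserves_chords_comb f f' _ (fun i => (x *m invmx B) ord0 i)
   (fun i => row i B) x pf sff' ff' sB sx); last by rewrite -mulmx_sum_row mulmxKV.
by rewrite [in RHS]mulmxA [RHS]mulmx_sum_row; apply: eq_bigr => i _; rewrite rowK.
Qed.

Section PreservedForms.
Context {f : 'rV[R]_4 -> 'rV[R]_4} {A : 'M[R]_4} (pf : preserves_chords f)
  (fA : forall x, sf x -> f x = x *m A).

Lemma linear_isometry_form x y : q (x *m A) (y *m A) = q x y.
Proof.
have [a [r [r0 sT]]] := tetrahedron_exists.
set B := tetrahedron a r in sT; have uB : B \in unitmx by exact: tetrahedron_unit.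
have qf z z' : sf z -> sf z' -> q (z *m A) (z' *m A) = q z z'.
  have [sff cf] := pf => sz sz'; rewrite -!fA//.
  by rewrite (q_chord rho _ _ (sff _ sz) (sff _ sz')) cf// -q_chord.
rewrite -{2}(mulmxKV uB x) -{2}(mulmxKV uB y) -{1}(mulmxKV uB x) -{1}(mulmxKV uB y).
rewrite !(mulmx_sum_row _ B) !mulmx_suml !wform_suml.
apply: eq_bigr => i _; rewrite -scalemxAl !wformZl; congr (_ * _).
rewrite wformC [RHS]wformC !wform_suml.
by apply: eq_bigr => j _; rewrite -scalemxAl !wformZl qf.
Qed.

Lemma linear_isometry_horizontal v : horizontal rho v -> horizontal rho (v *m A).
Proof.
move=> hv r0; have := linear_isometry_form v v; rewrite /wform r0 !mul0r !addr0 !mul1r hv//.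
by rewrite mulr0 => /eqP; rewrite mulf_eq0 orbb => /eqP.
Qed.

(** For rho = 0 the space form is an affine hyperplane and a horizontal vector
is a difference of two of its points, so its norm is a chord; polarization does
the rest. *)
Lemma linear_isometry_gdot v w : horizontal rho v -> horizontal rho w ->
  g (v *m A) (w *m A) = g v w.
Proof.
have [r0|rN0] := eqVneq rho 0; last first.
  move=> hv hw; apply: (mulfI rN0); rewrite -!q_horizontal//.
    exact: linear_isometry_form.
  by move=> e; rewrite e eqxx in rN0.
have [sff cf] := pf.
have [a [r [_ sT]]] := tetrahedron_exists; move: (row ord0 _) (sT ord0) => p sp.
have gv u : horizontal rho u -> g (u *m A) (u *m A) = g u u.
  move=> hu; have spu : sf (p + u).
    have hd : head_coord (p + u) = 1.
      by rewrite /head_coord mxE; have := hu r0; have := space_form_head_eq1 rho _ sp r0;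
        rewrite /head_coord => -> ->; rewrite addr0.
    by split; rewrite hd ?ltr01// r0 mul0r addr0 expr1n.
  by have := cf _ _ spu sp; rewrite /chord !fA// -mulmxBl addrC addKr.
move=> hv hw; have := gv _ (horizontalD _ _ _ hv hw); have := gv _ hv; have := gv _ hw.
by rewrite mulmxDl !wformE (wformC _ _ (w *m A) (v *m A)) (wformC _ _ w v); lra.
Qed.

End PreservedForms.

End LinearExtension.

(** * One-parameter groups of isometries *)

Record linear_isometry {R : realType} (rho : R) (A : 'M[R]_4) : Prop := LinearIsometry {
  li_space_form : forall x, space_form rho x -> space_form rho (x *m A);
  li_q : forall x y, wform 1 rho (x *m A) (y *m A) = wform 1 rho x y;
  li_horizontal : forall v, horizontal rho v -> horizontal rho (v *m A);
  li_gdot : forall v w, horizontal rho v -> horizontal rho w ->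
    wform rho^-1 1 (v *m A) (w *m A) = wform rho^-1 1 v w
}.
Arguments li_space_form {R rho A}.
Arguments li_q {R rho A}.
Arguments li_horizontal {R rho A}.
Arguments li_gdot {R rho A}.

Section LinearFlow.
Context {R : realType}.
Variable rho : R.
Implicit Types (v w x y z : 'rV[R]_4).
Local Notation g := (wform rho^-1 1).
Local Notation q := (wform 1 rho).
Local Notation sf := (space_form rho).

Section Flow.
Variable psi : R -> 'rV[R]_4 -> 'rV[R]_4.
Hypothesis gpsi : one_parameter_isometry_group rho psi.

Lemma flow_space_form t x : sf x -> sf (psi t x).
Proof. by case: (opg_isometric gpsi t) => + _; exact. Qed.

Lemma flowK t x : sf x -> psi t (psi (- t) x) = x.
Proof. by move=> sx; rewrite -(opg_add gpsi)// subrr (opg_zero gpsi). Qed.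

Lemma flow_preserves_chords t : preserves_chords rho (psi t).
Proof.
split=> [x|x y sx sy]; first exact: flow_space_form.
have sfx := flow_space_form t x sx; have sfy := flow_space_form t y sy.
have le1 := isometric_map_chord_le rho _ x y (opg_isometric gpsi t) sx sy.
have := isometric_map_chord_le rho _ _ _ (opg_isometric gpsi (- t)) sfx sfy.
have inv z : sf z -> psi (- t) (psi t z) = z.
  by move=> sz; have := flowK (- t) z sz; rewrite opprK.
by rewrite (inv x sx) (inv y sy) => le2; apply/le_anti; rewrite le1 le2.
Qed.

(** The matrix A t is built from the orbits of four spanning points, which are
smooth in t. The group law psi_(t + u) = psi_t psi_u, differentiated at u = 0,
shows that its derivative is Om *m A t. *)
Lemma flow_linear : exists (A : R -> 'M[R]_4) (Om : 'M[R]_4),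
  [/\ A 0 = 1%:M, forall t : R, is_derive t 1 A (Om *m A t),
      forall t x, sf x -> psi t x = x *m A t & forall t, linear_isometry rho (A t)].
Proof.
have [a [r [r0 sB]]] := tetrahedron_exists rho.
move: (tetrahedron a r) (tetrahedron_unit a r r0) sB => B uB sB.
pose A t := invmx B *m \matrix_i psi t (row i B).
have psiA t x : sf x -> psi t x = x *m A t.
  move=> sx; apply: (preserves_chords_linear rho (psi t) (psi (- t))) => //.
  - exact: flow_preserves_chords.
  - by move=> y; exact: flow_space_form.
  - by move=> y; exact: flowK.
have dpsi0 (x : 'rV[R]_4) (u : R) : sf x ->
    is_derive u 1 (fun h => psi h x) (derive1 (fun h => psi h x) u).
  by move=> sx; apply: smooth_is_derive1; exact: (opg_smooth gpsi).
have dpsi (x : 'rV[R]_4) (t : R) : sf x ->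
    is_derive t 1 (fun h => psi h x) (derive1 (fun h => psi h x) 0 *m A t).
  move=> sx; apply: is_derive_eq (dpsi0 x t sx) _; apply/matrixP => i j.
  have d1 : is_derive (0 : R) 1 (fun u => psi (t + u) x i j)
      (derive1 (fun h => psi h x) t i j).
    have ds : is_derive (0 : R) 1 (fun u => t + u) 1.
      have := is_deriveD (is_derive_cst t (0 : R) 1) (is_derive_id (0 : R) 1).
      by move=> /is_derive_eq; apply; rewrite add0r.
    have dt : is_derive (t + 0) 1 (fun h => psi h x i j)
        (derive1 (fun h => psi h x) t i j).
      by rewrite addr0; apply: is_derive_coord; exact: dpsi0.
    have := @is_derive1_comp _ (fun h => psi h x i j) (fun u => t + u) 0 _ _ dt ds.
    by move=> /is_derive_eq; apply; rewrite mulr1.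
  have d2 : is_derive (0 : R) 1 (fun u => psi (t + u) x i j)
      ((derive1 (fun h => psi h x) 0 *m A t) i j).
    have -> : (fun u => psi (t + u) x i j) = (fun u => (psi u x *m A t) i j).
      apply/funext => u; rewrite (opg_add gpsi)// psiA//.
      exact: flow_space_form.
    exact/is_derive_coord/is_derive_mulmxr/dpsi0.
  by rewrite -(is_derive_derive1 d1) (is_derive_derive1 d2).
exists A, (invmx B *m \matrix_i derive1 (fun h => psi h (row i B)) 0); split => //.
- rewrite /A; have -> : \matrix_i psi 0 (row i B) = B.
    by apply/row_matrixP => i; rewrite rowK (opg_zero gpsi).
  exact: mulVmx.
- move=> t; have dM : is_derive t 1 (fun h => \matrix_i psi h (row i B))
      (\matrix_i (derive1 (fun h => psi h (row i B)) 0 *m A t)).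
    apply: is_derive_mx => i j; rewrite mxE; under eq_fun do rewrite mxE.
    by apply: is_derive_coord; exact: dpsi.
  have := is_derive_mulmx (is_derive_cst (invmx B) t 1) dM.
  move=> /is_derive_eq; apply; rewrite mul0mx add0r -mulmxA; congr (_ *m _).
  by apply/row_matrixP => i; rewrite row_mul !rowK.
- move=> t; have pc := flow_preserves_chords t; split.
  + by move=> x sx; rewrite -psiA//; exact: flow_space_form.
  + exact: (linear_isometry_form rho pc (psiA t)).
  + exact: (linear_isometry_horizontal rho pc (psiA t)).
  + exact: (linear_isometry_gdot rho pc (psiA t)).
Qed.

End Flow.

(** Together with x, the frame is a basis of R^4: pairing a linear combination
with x for q and with the frame for g recovers its coefficients. *)
Lemma tangent_frame_expansion x (e : 'I_3 -> 'rV[R]_4) v :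
  sf x -> (forall i, q x (e i) = 0) -> (forall i j, g (e i) (e j) = (i == j)%:R) ->
  q x v = 0 -> v = \sum_i g v (e i) *: e i.
Proof.
move=> sx te ee tv.
pose M : 'M[R]_(1 + 3, 4) := col_mx x (\matrix_i e i).
have coords (u : 'rV[R]_(1 + 3)) : q x (u *m M) = 0 ->
    u = row_mx 0 (\row_i g (u *m M) (e i)).
  rewrite -{1 2 3}(hsubmxK u) mul_row_col (mulmx_sum_row (rsubmx u)).
  move: (lsubmx u) (rsubmx u) => a b.
  under eq_bigr do rewrite rowK.
  have -> : a *m x = a ord0 ord0 *: x.
    by rewrite mulmx_sum_row big_ord1; congr (_ *: _); apply/rowP => j; rewrite mxE.
  have q0 : q x (\sum_i b ord0 i *: e i) = 0.
    by rewrite wformC wform_suml big1// => i _; rewrite wformC wformZr te mulr0.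
  rewrite wformDr wformZr q0 (space_form_q _ _ sx) mulr1 addr0 => a0.
  congr row_mx; first by apply/matrixP => i j; rewrite !ord1 mxE.
  rewrite a0 scale0r add0r; apply/rowP => i; rewrite mxE.
  rewrite wform_suml (bigD1 i)//= wformZl ee eqxx mulr1 big1 ?addr0// => j ji.
  by rewrite wformZl ee (negbTE ji) mulr0.
have fM : row_free M.
  apply: inj_row_free => u uM; rewrite (coords u) uM ?[q x 0]wformC ?wform0l//.
  rewrite (_ : \row_i _ = 0) ?row_mx0//.
  by apply/rowP => i; rewrite !mxE wform0l.
have /submxP[u vE] : (v <= M)%MS by apply: submx_full; rewrite /row_full (eqP fM).
have := coords u; rewrite -vE => /(_ tv) uE.
rewrite {1}vE uE mul_row_col mul0mx add0r mulmx_sum_row.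
by apply: eq_bigr => i _; rewrite rowK mxE.
Qed.

End LinearFlow.

(** * Frenet equations and the Killing field along the curve *)

Section FrenetEquations.
Context {R : realType} {rho : R} {p n : 'rV[R]_4} {gamma N : R -> 'rV[R]_4}
  {kappa : R -> R}.
Hypotheses (sp : space_form rho p) (tn : tangent rho p n) (n1 : gdot rho n n = 1).
Hypothesis fc : frenet_curve rho p n gamma N kappa.
Local Notation g := (wform rho^-1 1).
Local Notation q := (wform 1 rho).
Local Notation sf := (space_form rho).
Local Notation T := (derive1 gamma).

Lemma frenet_space_form s : sf (gamma s).
Proof. by case: (fc_surface fc s). Qed.

Lemma frenet_is_derive_gamma (s : R) : is_derive s 1 gamma (T s).
Proof. exact/smooth_is_derive1/(fc_smooth fc). Qed.

Lemma frenet_is_derive_T (s : R) : is_derive s 1 T (derive1 T s).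
Proof. exact/smooth_is_derive1/smooth_derive1/(fc_smooth fc). Qed.

Lemma frenet_is_derive_N (s : R) : is_derive s 1 N (derive1 N s).
Proof. exact/smooth_is_derive1/(fc_normal_smooth fc). Qed.

Lemma frenet_tangent_T s : q (gamma s) (T s) = 0.
Proof.
have d := frenet_is_derive_gamma s.
have := wform_cst_derive (k := 1) d d (fun z => space_form_q _ _ (frenet_space_form z)).
by rewrite wformC; lra.
Qed.

Lemma frenet_tangent_N s : q (gamma s) (N s) = 0.
Proof. exact/tangentE/(fc_normal_tangent fc). Qed.

Lemma binormal_horizontal : horizontal rho n.
Proof. by apply: (tangent_horizontal rho p) => //; apply/tangentE. Qed.

Lemma frenet_tangent_n s : q (gamma s) n = 0.
Proof.
have hn := binormal_horizontal.
have [_ /eqP] := fc_surface fc s; rewrite gdotE wformDl wformNl subr_eq0 => /eqP e.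
rewrite q_horizontal// e -q_horizontal//.
exact/tangentE.
Qed.

Lemma frenet_horizontal s :
  [/\ horizontal rho (T s), horizontal rho (N s) & horizontal rho n].
Proof.
split; [| |exact: binormal_horizontal];
  apply: (tangent_horizontal rho _ _ (frenet_space_form s)).
- exact: frenet_tangent_T.
- exact: frenet_tangent_N.
Qed.

Lemma frenet_TT s : g (T s) (T s) = 1.
Proof. by rewrite -gdotE (fc_unit_speed fc). Qed.

Lemma frenet_NN s : g (N s) (N s) = 1.
Proof. by rewrite -gdotE (fc_normal_unit fc). Qed.

Lemma frenet_nn : g n n = 1.
Proof. by rewrite -gdotE. Qed.

Lemma frenet_NT s : g (N s) (T s) = 0.
Proof. by rewrite -gdotE (fc_normal_T fc). Qed.

Lemma frenet_Nn s : g (N s) n = 0.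
Proof. by rewrite -gdotE (fc_normal_n fc). Qed.

Lemma frenet_Tn s : g (T s) n = 0.
Proof.
have d1 := frenet_is_derive_gamma s.
have d2 := is_derive_cst n s (1 : R).
have h z : g (gamma z) (cst n z) = g p n.
  have [_ /eqP] := fc_surface fc z.
  by rewrite gdotE wformDl wformNl subr_eq0 => /eqP.
have := wform_cst_derive d1 d2 h.
by rewrite [X in _ + X]wformC wform0l addr0.
Qed.

(** The component of the acceleration along gamma comes from differentiating
q gamma T = 0. *)
Lemma frenet_derive2 s : derive1 T s = kappa s *: N s - rho *: gamma s.
Proof.
have := fc_curvature fc s; rewrite /cov_deriv /tan_proj gdotE => /eqP.
rewrite subr_eq => /eqP eT; rewrite {1}eT; congr (_ + _).
rewrite -scaleNr; congr (_ *: _).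
have [->|rN0] := eqVneq rho 0; first by rewrite mul0r oppr0.
have hT2 : horizontal rho (derive1 T s) by move=> e; rewrite e eqxx in rN0.
rewrite -q_horizontal//.
have := wform_cst_derive (k := 0) (frenet_is_derive_gamma s) (frenet_is_derive_T s)
  frenet_tangent_T.
have [hT _ _] := frenet_horizontal s.
by rewrite (q_horizontal _ _ _ hT) frenet_TT; lra.
Qed.

(** The index 2 falls off the list, so that the default value n completes the
frame. *)
Definition frenet_frame s (i : 'I_3) : 'rV[R]_4 := nth n [:: T s; N s] i.

Lemma frenet_frame_horizontal s i : horizontal rho (frenet_frame s i).
Proof. by have [? ? ?] := frenet_horizontal s; case: i => [[|[|[|//]]] ?]. Qed.

Lemma frenet_frame_tangent s i : q (gamma s) (frenet_frame s i) = 0.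
Proof.
case: i => [[|[|[|//]]] ?]; rewrite /frenet_frame/=;
  [exact: frenet_tangent_T|exact: frenet_tangent_N|exact: frenet_tangent_n].
Qed.

Lemma frenet_frame_orthonormal s i j :
  g (frenet_frame s i) (frenet_frame s j) = (i == j)%:R.
Proof.
case: i => [[|[|[|//]]] ?]; case: j => [[|[|[|//]]] ?]; rewrite /frenet_frame/=;
  rewrite ?frenet_TT ?frenet_NN ?frenet_nn ?frenet_NT ?frenet_Nn ?frenet_Tn//;
  by rewrite wformC ?frenet_NT ?frenet_Nn ?frenet_Tn.
Qed.

Lemma frenet_expansion A s v : linear_isometry rho A -> q (gamma s *m A) v = 0 ->
  v = g v (T s *m A) *: (T s *m A) + g v (N s *m A) *: (N s *m A)
      + g v (n *m A) *: (n *m A).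
Proof.
move=> iA tv.
have := tangent_frame_expansion rho (gamma s *m A) (fun i => frenet_frame s i *m A) v.
move=> /(_ (li_space_form iA _ (frenet_space_form s))) => h; rewrite {1}h => {h}//.
- by rewrite !big_ord_recl big_ord0 addr0 /frenet_frame/= addrA.
- by move=> i; rewrite (li_q iA) frenet_frame_tangent.
- move=> i j; rewrite (li_gdot iA); [exact: frenet_frame_orthonormal|..];
    exact: frenet_frame_horizontal.
Qed.

Lemma linear_isometry1 : linear_isometry rho 1%:M.
Proof. by split=> *; rewrite !mulmx1. Qed.

Lemma frenet_derive_N s : derive1 N s = - kappa s *: T s.
Proof.
have [hT hN hn] := frenet_horizontal s.
have dN := frenet_is_derive_N s; have dg := frenet_is_derive_gamma s.
have tN' : q (gamma s) (derive1 N s) = 0.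
  have := wform_cst_derive (k := 0) dg dN frenet_tangent_N.
  by rewrite (q_horizontal _ _ _ hN) (wformC _ _ (T s)) frenet_NT; lra.
have := frenet_expansion 1%:M s (derive1 N s) linear_isometry1.
rewrite !mulmx1 => /(_ tN') ->.
have -> : g (derive1 N s) (N s) = 0.
  have := wform_cst_derive dN dN frenet_NN.
  by rewrite (wformC _ _ (N s)); lra.
have -> : g (derive1 N s) n = 0.
  have := wform_cst_derive dN (is_derive_cst n s (1 : R)) frenet_Nn.
  by rewrite [X in _ + X]wformC wform0l addr0.
have -> : g (derive1 N s) (T s) = - kappa s.
  have := wform_cst_derive dN (frenet_is_derive_T s) frenet_NT.
  rewrite frenet_derive2 !wformE frenet_NN => e.
  have : rho * g (N s) (gamma s) = 0.
    by rewrite wformC -q_horizontal// frenet_tangent_N.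
  by lra.
by rewrite !scale0r !addr0.
Qed.

Lemma frenet_curvatureE : kappa = (fun s => g (derive1 T s) (N s)).
Proof.
apply/funext => s; rewrite frenet_derive2 !wformE frenet_NN.
have [_ hN _] := frenet_horizontal s.
by rewrite -(q_horizontal _ _ _ hN) frenet_tangent_N; lra.
Qed.

Lemma frenet_is_derive_kappa (s : R) : is_derive s 1 kappa (derive1 kappa s).
Proof.
apply: derivable_is_derive1; rewrite frenet_curvatureE.
have d3 := smooth_is_derive1 s (smooth_derive1 (smooth_derive1 (fc_smooth fc))).
by case: (is_derive_wform rho^-1 1 d3 (frenet_is_derive_N s)).
Qed.

Section KillingAlong.
Context {A : R -> 'M[R]_4} {Om : 'M[R]_4} {J : set R} {P : R -> R}.
Hypotheses (A0 : A 0 = 1%:M) (dA : forall t : R, is_derive t 1 A (Om *m A t))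
  (iA : forall t, linear_isometry rho (A t)).
Hypotheses (smoothP : smooth_on J P) (hJ : forall s, J (kappa s)).
Local Notation f := (derive1 P \o kappa).
Hypothesis gOm : forall s, gamma s *m Om = f s *: n.

Lemma is_derive_flow (x : 'rV[R]_4) (t : R) :
  is_derive t 1 (fun z => x *m A z) (x *m Om *m A t).
Proof.
have := is_derive_mulmx (is_derive_cst x t 1) (dA t).
by move=> /is_derive_eq; apply; rewrite mul0mx add0r mulmxA.
Qed.

(** Both skewness relations express, at t = 0, that A t preserves the forms. *)
Lemma generator_skew_q (x y : 'rV[R]_4) : q (x *m Om) y + q x (y *m Om) = 0.
Proof.
have := wform_cst_derive (is_derive_flow x 0) (is_derive_flow y 0)
  (fun t => li_q (iA t) x y).
by rewrite A0 !mulmx1.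
Qed.

Lemma generator_skew_gdot (v w : 'rV[R]_4) : horizontal rho v -> horizontal rho w ->
  g (v *m Om) w + g v (w *m Om) = 0.
Proof.
move=> hv hw.
have := wform_cst_derive (is_derive_flow v 0) (is_derive_flow w 0)
  (fun t => li_gdot (iA t) v w hv hw).
by rewrite A0 !mulmx1.
Qed.

Lemma is_derive_dotn {c : R -> 'rV[R]_4} {c' : 'rV[R]_4} {s : R} : is_derive s 1 c c' ->
  is_derive s 1 (fun z => g (c z) n) (g c' n).
Proof.
move=> dc; have := is_derive_wform rho^-1 1 dc (is_derive_cst n s (1 : R)).
by move=> /is_derive_eq; apply; rewrite [X in _ + X]wformC wform0l addr0.
Qed.

Lemma killing_speedE : f = (fun s => g (gamma s *m Om) n).
Proof. by apply/funext => s; rewrite gOm wformZl frenet_nn mulr1. Qed.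

Lemma is_derive_killing_speed (s : R) : is_derive s 1 f (g (T s *m Om) n).
Proof.
by rewrite killing_speedE; apply/is_derive_dotn/is_derive_mulmxr/frenet_is_derive_gamma.
Qed.

Lemma derive_killing_speed : derive1 f = (fun s => g (T s *m Om) n).
Proof. by apply/funext => s; exact/is_derive_derive1/is_derive_killing_speed. Qed.

Lemma derive2_killing_speed s : derive1n 2 f s = g (derive1 T s *m Om) n.
Proof.
rewrite derive1nS derive1n1 derive_killing_speed.
exact/is_derive_derive1/is_derive_dotn/is_derive_mulmxr/frenet_is_derive_T.
Qed.

Lemma generator_T s : T s *m Om = derive1 f s *: n.
Proof.
have d1 := is_derive_mulmxr Om (frenet_is_derive_gamma s).
have d2 := is_derive_scalel n (is_derive_killing_speed s).
rewrite derive_killing_speed -(is_derive_derive1 d2) -(is_derive_derive1 d1).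
by congr (derive1 _ s); apply/funext => z; rewrite gOm.
Qed.

Definition binormal_rate s : R := g (N s *m Om) n.

(** Skewness of Om carries the components of N Om along gamma, T and N over to
pairings of N with gamma Om, T Om and N Om. The first two vectors are multiples
of n, hence orthogonal to N, and the last pairing is its own opposite. *)
Lemma generator_N s : N s *m Om = binormal_rate s *: n.
Proof.
have [hT hN hn] := frenet_horizontal s.
have tNO : q (gamma s) (N s *m Om) = 0.
  have := generator_skew_q (gamma s) (N s); rewrite gOm wformZl.
  by rewrite (q_horizontal _ _ _ hN) (wformC _ _ n) frenet_Nn; lra.
have := frenet_expansion 1%:M s (N s *m Om) linear_isometry1.
rewrite !mulmx1 => /(_ tNO) ->.
have -> : g (N s *m Om) (T s) = 0.
  have := generator_skew_gdot (N s) (T s) hN hT.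
  by rewrite generator_T wformZr frenet_Nn mulr0 addr0.
have -> : g (N s *m Om) (N s) = 0.
  by have := generator_skew_gdot (N s) (N s) hN hN; rewrite (wformC _ _ (N s) (_ *m _)); lra.
by rewrite !scale0r !add0r.
Qed.

Lemma is_derive_binormal_rate (s : R) :
  is_derive s 1 binormal_rate (- kappa s * derive1 f s).
Proof.
have := is_derive_dotn (is_derive_mulmxr Om (frenet_is_derive_N s)).
move=> /is_derive_eq; apply.
by rewrite frenet_derive_N -scalemxAl wformZl generator_T wformZl frenet_nn mulr1.
Qed.

(** The Euler-Lagrange equation gives this identity multiplied by kappa s, and so
proves it where kappa does not vanish, in particular at some s0. Both sides have
derivative - kappa f', so their difference is constant, which settles the zeros
of kappa. *)
Lemma binormal_rateE : euler_lagrange rho P kappa ->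
  (exists s1 s2, kappa s1 <> kappa s2) ->
  forall s, binormal_rate s = P (kappa s) - kappa s * f s.
Proof.
move=> EL [s1 [s2 s12]] s.
have [s0 k0] : exists s0, kappa s0 != 0.
  have [e1|] := eqVneq (kappa s1) 0; last by exists s1.
  by exists s2; apply/eqP => e2; apply: s12; rewrite e1.
have at0 : binormal_rate s0 = P (kappa s0) - kappa s0 * f s0.
  apply: (mulfI k0).
  have := EL s0; rewrite derive2_killing_speed frenet_derive2 mulmxBl -!scalemxAl.
  rewrite gOm generator_N wformDl wformNl !wformZl frenet_nn /= => e.
  by lra.
pose G s := binormal_rate s - (P (kappa s) - kappa s * f s).
have dG (u : R) : is_derive u 1 G 0.
  have dk := frenet_is_derive_kappa u.
  have dP : is_derive (kappa u) 1 P (derive1 P (kappa u)).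
    by apply: derivable_is_derive1; exact: (smoothP 0%N _ (hJ u)).
  have dPk := @is_derive1_comp _ P kappa u _ _ dP dk.
  have := is_deriveB (is_derive_binormal_rate u)
    (is_deriveB dPk (is_derive_mul dk (is_derive_killing_speed u))).
  by move=> /is_derive_eq; apply; rewrite derive_killing_speed /=; ring.
have := @is_derive_0_is_cst _ G s s0 dG; rewrite /G at0 subrr; lra.
Qed.

End KillingAlong.
End FrenetEquations.

(** * Shape operator of the evolution surface *)

Section EvolutionSurface.
Context {R : realType} {rho : R} {p n : 'rV[R]_4} {gamma N : R -> 'rV[R]_4}
  {kappa : R -> R}.
Hypotheses (sp : space_form rho p) (tn : tangent rho p n) (n1 : gdot rho n n = 1).
Hypothesis fc : frenet_curve rho p n gamma N kappa.
Local Notation g := (wform rho^-1 1).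
Local Notation q := (wform 1 rho).
Local Notation sf := (space_form rho).
Local Notation T := (derive1 gamma).

Lemma tan_proj_id x w : sf x -> q x w = 0 -> tan_proj rho x w = w.
Proof.
move=> sx tw; rewrite /tan_proj gdotE -q_horizontal; last exact: tangent_horizontal tw.
by rewrite tw scale0r subr0.
Qed.

Lemma free_orthogonal (v w : 'rV[R]_4) : g v v = 1 -> g v w = 0 -> w != 0 ->
  free [:: v; w].
Proof.
move=> v1 vw w0; rewrite free_cons seq1_free w0 andbT span_seq1.
apply/negP => /vlineP[k vE]; have := v1.
by rewrite {2}vE wformZr vw mulr0 => /eqP; rewrite eq_sym oner_eq0.
Qed.

Context {A : R -> 'M[R]_4} {Om : 'M[R]_4} {f : R -> R}.
Context {X nu : R -> R -> 'rV[R]_4}.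
Hypotheses (A0 : A 0 = 1%:M) (dA : forall t : R, is_derive t 1 A (Om *m A t))
  (iA : forall t, linear_isometry rho (A t)).
Hypothesis XE : forall s t, X s t = gamma s *m A t.
Hypothesis gOm : forall s, gamma s *m Om = f s *: n.
Hypothesis hnu : unit_normal rho X nu.
Hypothesis nuN : forall s, nu s 0 = - N s.

Lemma evolution_partial_s s t : partial_s X s t = T s *m A t.
Proof.
rewrite /partial_s; under eq_fun do rewrite XE.
exact/is_derive_derive1/is_derive_mulmxr/(frenet_is_derive_gamma fc).
Qed.

Lemma evolution_partial_t s t : partial_t X s t = f s *: (n *m A t).
Proof.
rewrite /partial_t; under eq_fun do rewrite XE.
by rewrite (is_derive_derive1 (is_derive_flow dA (gamma s) t)) gOm scalemxAl.
Qed.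

(** At a regular point the unit normal is determined up to sign. The sign sigma
is differentiable in t with sigma^2 = 1, hence constant along the orbit, and at
t = 0 it is -1. *)
Lemma evolution_unit_normal s t : f s != 0 -> nu s t = - (N s *m A t).
Proof.
move=> f0; have [hT hN hn] := frenet_horizontal sp tn fc s.
pose sigma (u : R) := g (nu s u) (N s *m A u).
have nuE u : nu s u = sigma u *: (N s *m A u).
  have tnu : q (gamma s *m A u) (nu s u) = 0.
    by rewrite -XE; apply/tangentE; exact: (un_tangent hnu).
  rewrite {1}(frenet_expansion sp tn n1 fc (A u) s (nu s u) (iA u) tnu).
  have -> : g (nu s u) (T s *m A u) = 0.
    by rewrite -evolution_partial_s -gdotE (un_normal_s hnu).
  have -> : g (nu s u) (n *m A u) = 0.
    have := un_normal_t hnu s u; rewrite gdotE evolution_partial_t wformZr => /eqP.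
    by rewrite mulf_eq0 (negbTE f0) => /eqP.
  by rewrite !scale0r add0r addr0.
have NN u : g (N s *m A u) (N s *m A u) = 1.
  by rewrite (li_gdot (iA u))// (frenet_NN fc).
have sigma2 u : sigma u * sigma u = 1.
  by have := un_unit hnu s u; rewrite gdotE nuE wformZl wformZr NN mulr1.
have dsigma (u : R) : is_derive u 1 sigma 0.
  have dnu := smooth_is_derive1 u (@un_smooth_t _ _ _ _ hnu s).
  have ds := is_derive_wform rho^-1 1 dnu (is_derive_flow dA (N s) u).
  apply: is_derive_eq (ds) _; move: ds.
  rewrite -/sigma; set d := _ + _ => ds.
  have := is_derive_derive1 (is_derive_mul ds ds).
  have -> : (fun z => sigma z * sigma z) = cst 1 by apply/funext.
  rewrite derive1_cst => e.
  have /eqP : d * sigma u = 0 by lra.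
  have s0 : sigma u != 0.
    by apply/eqP => s0; have := sigma2 u; rewrite s0 mul0r => /eqP; rewrite eq_sym oner_eq0.
  by rewrite mulf_eq0 (negbTE s0) orbF => /eqP.
rewrite nuE (@is_derive_0_is_cst _ sigma t 0 dsigma).
by rewrite /sigma nuN A0 mulmx1 wformNl (frenet_NN fc) scaleN1r.
Qed.

Lemma evolution_tangent s t v : q (gamma s) v = 0 -> q (X s t) (v *m A t) = 0.
Proof. by rewrite XE (li_q (iA t)). Qed.

Lemma evolution_space_form s t : sf (X s t).
Proof. by rewrite XE; apply: (li_space_form (iA t)); exact: (frenet_space_form fc). Qed.

(** Continuity of f extends the formula for the normal to a neighbourhood of s,
which its s-derivative needs. *)
Lemma evolution_shape_s s t : {for s, continuous f} -> f s != 0 ->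
  shape_s rho X nu s t = - kappa s *: partial_s X s t.
Proof.
move=> cf f0; rewrite /shape_s /cov_deriv.
have -> : derive1 (fun u => nu u t) s = kappa s *: (T s *m A t).
  rewrite derive1E.
  rewrite -(@near_eq_derive _ _ _ (fun u => - (N u *m A t)) (fun u => nu u t)).
    have dN := is_deriveN (is_derive_mulmxr (A t) (frenet_is_derive_N fc s)).
    rewrite (@derive_val _ _ _ _ _ _ _ dN) (frenet_derive_N sp tn n1 fc).
    by rewrite scaleNr mulNmx opprK scalemxAl.
  have : \near s, f s != 0 by exact: cvgr_neq0 cf f0.
  by apply: filterS => u fu; rewrite evolution_unit_normal.
rewrite tan_proj_id ?evolution_partial_s ?scaleNr//; first exact: evolution_space_form.
by rewrite wformZr evolution_tangent ?mulr0//; exact: (frenet_tangent_T fc).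
Qed.

Lemma evolution_shape_t s t (l : R) : f s != 0 -> N s *m Om = l *: n ->
  shape_t rho X nu s t = (l / f s) *: partial_t X s t.
Proof.
move=> f0 NOm; rewrite /shape_t /cov_deriv.
have -> : derive1 (nu s) t = - l *: (n *m A t).
  have -> : nu s = (fun u => - (N s *m A u)).
    by apply/funext => u; exact: evolution_unit_normal.
  rewrite (is_derive_derive1 (is_deriveN (is_derive_flow dA (N s) t))).
  by rewrite NOm scaleNr scalemxAl.
rewrite tan_proj_id.
- by rewrite evolution_partial_t scalerA divfK// scaleNr opprK.
- exact: evolution_space_form.
by rewrite wformZr evolution_tangent ?mulr0//; exact: (frenet_tangent_n sp tn fc).
Qed.

Lemma evolution_free s t : f s != 0 -> free [:: partial_s X s t; partial_t X s t].
Proof.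
move=> f0; have [hT hN hn] := frenet_horizontal sp tn fc s.
rewrite evolution_partial_s evolution_partial_t; apply: free_orthogonal.
- by rewrite (li_gdot (iA t))// (frenet_TT fc).
- by rewrite wformZr (li_gdot (iA t))// (frenet_Tn fc) mulr0.
rewrite scaler_eq0 (negbTE f0)/=; apply/eqP => nA.
have := li_gdot (iA t) n n hn hn.
by rewrite nA wform0l (frenet_nn n1) => /eqP; rewrite eq_sym oner_eq0.
Qed.

End EvolutionSurface.

Theorem theorem5p2 (R : realType) (rho d : R)
    (J : set R) (P : R -> R)
    (p n : 'rV[R]_4) (gamma N : R -> 'rV[R]_4) (kappa : R -> R)
    (xi : 'rV[R]_4 -> 'rV[R]_4) (psi : R -> 'rV[R]_4 -> 'rV[R]_4)
    (nu : R -> R -> 'rV[R]_4)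
    (* P is smooth on the open set J *)
    (openJ : open J) (smoothP : smooth_on J P)
    (* B(rho): the totally geodesic surface through p with unit normal n *)
    (hp : space_form rho p) (hn : tangent rho p n) (hn1 : gdot rho n n = 1)
    (* gamma: closed critical curve in B(rho), non-constant curvature, d > 0 *)
    (hgamma : frenet_curve rho p n gamma N kappa)
    (hclosed : closed_curve gamma)
    (hJ : forall s, J (kappa s))
    (hcritical : euler_lagrange rho P kappa)
    (hnonconst : exists s1 s2, kappa s1 <> kappa s2)
    (hd : forall s, first_integral rho P kappa s = d) (hd0 : 0 < d)
    (* the Killing field xi extending I = P'(kappa) B, and its flow *)
    (hpsi : killing_field_with_flow rho xi psi)
    (hI : forall s, xi (gamma s) = derive1 P (kappa s) *: n)
    (* unit normal of the evolution surface, equal to - N along gamma *)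
    (hnu : unit_normal rho (binormal_evolution psi gamma) nu)
    (hnuN : forall s, nu s 0 = - N s) :
  forall s t, derive1 P (kappa s) != 0 ->
    exists k1 k2 : R,
      principal_curvatures rho (binormal_evolution psi gamma) nu s t k1 k2 /\
      k1 = k2 - P (kappa s) / derive1 P (kappa s).
Proof.
move=> s t f0; have [gpsi dpsi] := hpsi.
have [A [Om [A0 dA psiA iA]]] := flow_linear rho psi gpsi.
have sfg u : space_form rho (gamma u) by exact: (frenet_space_form hgamma).
pose f := derive1 P \o kappa.
have gOm u : gamma u *m Om = f u *: n.
  rewrite -hI -dpsi//; have -> : (fun t => psi t (gamma u)) = (fun t => gamma u *m A t).
    by apply/funext => z; exact: psiA.
  by rewrite (is_derive_derive1 (is_derive_flow dA (gamma u) 0)) A0 mulmx1.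
have XE u z : binormal_evolution psi gamma u z = gamma u *m A z by exact: psiA.
have cf : {for s, continuous f}.
  apply/differentiable_continuous/derivable1_diffP.
  by case: (is_derive_killing_speed hn1 hgamma gOm s).
have rateE := binormal_rateE hp hn hn1 hgamma A0 dA iA smoothP hJ gOm hcritical
  hnonconst s.
have NOm := generator_N hp hn hn1 hgamma A0 dA iA gOm s.
exists (- kappa s), (binormal_rate (rho := rho) (n := n) (N := N) (Om := Om) s / f s).
split; last by rewrite rateE /f/=; field.
split.
- exact: (evolution_free hp hn hn1 hgamma dA iA XE gOm s t f0).
- exact: (evolution_shape_s hp hn hn1 hgamma A0 dA iA XE gOm hnu hnuN s t cf f0).
- exact: (evolution_shape_t hp hn hn1 hgamma A0 dA iA XE gOm hnu hnuN s t _ f0 NOm).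
Qed.
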